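(* Let $R\in\mathbb{R}^{d\times d}$ be constant with $R=R^\top\succeq0$, let $\mathcal{X}\subset\mathbb{R}^d$ be open, let $\mathcal{H}:\mathcal{X}\to\mathbb{R}$ be sufficiently smooth, and consider the purely dissipative system $\dot x=-R\nabla\mathcal{H}(x)$, $x(0)=x_0$. Define $$Z(x,h)=-\frac{h^2}{12}R\,\nabla^2\mathcal{H}(x)\,R\,\nabla^2\mathcal{H}(x),\qquad \overline R_{\exp}(x,y,h)=\exp\!\big(Z(\tfrac{x+y}{2},h)\big)\,R.$$ Then $\overline R_{\exp}$ is a fourth-order symmetric positive semi-definite completion of $$\widetilde R(x,y,h)=R-\frac{h^2}{12}R\,\nabla^2\mathcal{H}(\tfrac{x+y}{2})\,R\,\nabla^2\mathcal{H}(\tfrac{x+y}{2})\,R,$$ and the modified AVF discrete gradient method $$\frac{x_{n+1}-x_n}{h}=-\overline R_{\exp}(x_n,x_{n+1},h)\,\overline\nabla_{\mathrm{AVF}}\mathcal{H}(x_n,x_{n+1})$$ is energy-consistent and of fourth order.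
   Context: All functions of $(x,y)$ and all numerical steps are considered for pairs $(x,y)\in\mathcal{X}\times\mathcal{X}$ for which the segment between $x$ and $y$ lies in $\mathcal{X}$. The average vector field (AVF) discrete gradient is $\overline\nabla_{\mathrm{AVF}}\mathcal{H}(x,y)=\int_0^1\nabla\mathcal{H}((1-\xi)x+\xi y)\,\mathrm{d}\xi$; $\nabla^2\mathcal{H}$ is the Hessian; $\exp$ is the matrix exponential. ''Sufficiently smooth'' means of class $C^k$ for a sufficiently large fixed integer $k$. A fourth-order symmetric positive semi-definite completion of $\widetilde R$ is a matrix function $\overline R$ with $\overline R(x,y,h)=\overline R(x,y,h)^\top\succeq0$ for all $(x,y)$ and all $h>0$, and $\overline R=\widetilde R+O(h^4)$ as $h\to0$ (locally uniformly in $(x,y)$). Energy-consistent (here with vanishing skew-symmetric part): $\overline R$ is pointwise symmetric positive semi-definite, $\lim_{y\to x,\,h\to0}\overline R(x,y,h)=R$, and consequently every numerical step satisfies $\mathcal{H}(x_{n+1})-\mathcal{H}(x_n)\le0$ for every step size $h>0$, with equality if $R=0$. Of fourth order: the local (one-step) error is $O(h^5)$, that is, if $x(t)$ is the exact solution with $x(0)=x_0$ and $x_1=x_1(h)$ solves the scheme started at $x_0$ with step size $h$ and $x_1(h)\to x_0$ as $h\to0$, then $\|x(h)-x_1(h)\|=O(h^5)$ as $h\to0$. *)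

(* Defs.v *)
From HB Require Import structures.
From mathcomp Require Import all_boot all_order all_algebra.
From mathcomp Require Import all_classical all_reals all_analysis.

Set Implicit Arguments.
Unset Strict Implicit.
Unset Printing Implicit Defensive.

Import Order.TTheory GRing.Theory Num.Theory.
Import numFieldNormedType.Exports.

Local Open Scope classical_set_scope.
Local Open Scope ring_scope.

(* A real function on an open set X is represented by a total function on
   'cV[R]_d. All hypotheses bear on its values on X only, and the (partial)
   derivatives below are only used at points of the open set X, where they do
   not depend on the values outside X. *)

Section Calculus.
Context {R : realType} {d : nat}.
Implicit Types (X : set 'cV[R]_d) (H : 'cV[R]_d -> R) (x y : 'cV[R]_d).

Definition partial (i : 'I_d) H x : R := 'D_(delta_mx i 0) H x.

Fixpoint class_C (k : nat) X H : Prop :=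
  match k with
  | 0 => forall x, X x -> {for x, continuous H}
  | k'.+1 => (forall x, X x -> differentiable H x) /\
             (forall i, class_C k' X (partial i H))
  end.

Definition grad H x : 'cV[R]_d := \col_i partial i H x.

Definition hessian H x : 'M[R]_d :=
  \matrix_(i, j) partial i (partial j H) x.

Definition expmx (M : 'M[R]_d) : 'M[R]_d :=
  limn (series (fun n => (n`!%:R)^-1 *: M ^+ n)).

Definition sym_psd (M : 'M[R]_d) : Prop :=
  M^T = M /\ forall v : 'cV[R]_d, 0 <= (v^T *m M *m v) 0 0.

Definition segment_in X x y : Prop :=
  forall xi : R, 0 <= xi <= 1 -> X ((1 - xi) *: x + xi *: y).

Definition avf H x y : 'cV[R]_d :=
  \col_i (\int[lebesgue_measure]_(xi in `[0, 1])
            grad H ((1 - xi) *: x + xi *: y) i 0).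

Definition midpoint x y : 'cV[R]_d := 2^-1 *: (x + y).

End Calculus.

Section Scheme.
Context {R : realType} {d : nat}.
Implicit Types (X : set 'cV[R]_d) (H : 'cV[R]_d -> R) (A : 'M[R]_d).
Implicit Types (Rbar Rtilde : 'cV[R]_d -> 'cV[R]_d -> R -> 'M[R]_d).

Definition pointwise_sym_psd X Rbar : Prop :=
  forall x y h, segment_in X x y -> 0 < h -> sym_psd (Rbar x y h).

(* The product filter makes the O-constant and the range of h uniform over a
   neighbourhood of (x, y). For X open, all pairs near an admissible pair are
   admissible. *)
Definition sym_psd_completion (p : nat) X Rtilde Rbar : Prop :=
  pointwise_sym_psd X Rbar /\
  forall x y, segment_in X x y ->
    let F := filter_prod (nbhs (x, y)) 0^'+ in
    (fun u : ('cV[R]_d * 'cV[R]_d) * R =>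
       Rbar u.1.1 u.1.2 u.2 - Rtilde u.1.1 u.1.2 u.2)
    =O_F (fun u => u.2 ^+ p : R).

Definition dg_step X H Rbar x y (h : R) : Prop :=
  [/\ 0 < h, segment_in X x y &
      h^-1 *: (y - x) = - (Rbar x y h *m avf H x y)].

Definition energy_consistent X H A Rbar : Prop :=
  [/\ pointwise_sym_psd X Rbar,
      forall x, X x ->
        Rbar x u.1 u.2 @[u --> filter_prod (nbhs x) 0^'+] --> A,
      forall x y h, dg_step X H Rbar x y h -> H y - H x <= 0 &
      A = 0 -> forall x y h, dg_step X H Rbar x y h -> H y - H x = 0].

(* A local forward solution of x' = - A grad H(x), x(0) = x0. The one-sided
   derivative at 0 need not be postulated: for grad H continuous on X it
   follows from continuity of x at 0 and the equation on ]0, T[. *)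
Definition exact_solution X H A (x0 : 'cV[R]_d) (x : R -> 'cV[R]_d) : Prop :=
  exists2 T : R, 0 < T &
    [/\ x 0 = x0,
        {within `[0, T[, continuous x},
        forall t, 0 <= t < T -> X (x t) &
        forall t, 0 < t < T -> is_derive t 1 x (- (A *m grad H (x t)))].

(* x1 is any branch of solutions of the scheme, given for small h > 0, that
   converges to x0; the local error is compared with h ^ (p + 1). *)
Definition method_of_order (p : nat) X H A Rbar : Prop :=
  forall (x0 : 'cV[R]_d) (x x1 : R -> 'cV[R]_d),
    exact_solution X H A x0 x ->
    (\forall h \near 0^'+, dg_step X H Rbar x0 (x1 h) h) ->
    x1 h @[h --> 0^'+] --> x0 ->
    let F := (0 : R)^'+ in
    (fun h : R => x h - x1 h) =O_F (fun h => h ^+ p.+1 : R).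

Definition Zmat H A x (h : R) : 'M[R]_d :=
  - (h ^+ 2 / 12) *: (A *m hessian H x *m A *m hessian H x).

Definition Rexp H A x y (h : R) : 'M[R]_d :=
  expmx (Zmat H A (midpoint x y) h) *m A.

Definition Rtilde4 H A x y (h : R) : 'M[R]_d :=
  let B := hessian H (midpoint x y) in
  A - (h ^+ 2 / 12) *: (A *m B *m A *m B *m A).

End Scheme.

(* Main.v *)
Require Import Defs.
From HB Require Import structures.
From mathcomp Require Import all_boot all_order all_algebra.
From mathcomp Require Import all_classical all_reals all_analysis.
From mathcomp Require Import ring lra.

Set Implicit Arguments.
Unset Strict Implicit.
Unset Printing Implicit Defensive.

Import Order.TTheory GRing.Theory Num.Theory.
Import numFieldNormedType.Exports.

Local Open Scope classical_set_scope.
Local Open Scope ring_scope.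

(** Let [B] be the Hessian of [H] and [Z = - (h^2 / 12) A B A B], taken at the
    midpoint of the two arguments.

    Completion.  Since [A] and [B] are symmetric, [Z A = A Z^T]; hence
    [exp Z A = exp (Z / 2) A exp (Z / 2)^T] is congruent to [A], so it is
    symmetric and positive semi-definite ([sym_psd_expmx]).  The Hessian is
    locally bounded, so [Z = O(h^2)] and [exp Z - 1 - Z = O(h^4)] locally
    uniformly ([dominated_expmx_Zmat]), and [A + Z A] is the prescribed matrix.

    Energy.  By the fundamental theorem of calculus along the segment from [x]
    to [y], [H y - H x] is the scalar product of [y - x] with the average vector
    field ([energy_identity]).  On a step this equals
    [- h avf^T (exp Z A) avf <= 0] ([dissipation_le0]).

    Order, consistency.  Let [x] be an exact solution, [g] the gradient of [H],
    and expand [x] at the middle of the step.  The solution and its chord from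
    [x 0] to [x h] share their end points; with [sigma = 2 xi - 1] their
    difference at [xi h] is
    [(h^2 / 8) (sigma^2 - 1) x''] plus a multiple of the odd polynomial
    [sigma^3 - sigma], up to [O(h^4)] ([stepO_chord_error]).  Multiplying
    by the Hessian on the chord, whose linear variation is odd in [sigma] too,
    gives the difference of [g] on the two curves ([stepO_gradient_expansion]).  On the unit interval [sigma^2 - 1]
    has integral [- 2 / 3] and the odd polynomial [0].  As
    [(x h - x 0) / h] is [- A] times the mean of [g] on the solution, and [avf] is
    its mean on the chord,
    [(x h - x 0) / h + A avf = (h^2 / 12) A B x'' + O(h^4)] ([stepO_average]).
    Finally [x'' = - A B x'] and [x' = - A avf + O(h^2)] turn the right-hand side
    into [(h^2 / 12) A B A B A avf]: the residual of the exact solution in the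
    scheme is [O(h^4)] ([stepO_defect]).

    Order, stability.  The increment function with [A + Z A] in place of the
    completion depends on the end point in a Lipschitz way
    ([dominated_increment_sub]), and the replacement costs [O(h^4)],
    so the error [e] of one step satisfies [|e| / h <= C h^4 + D |e|], and [e = O(h^5)]
    ([method_of_order_Rexp]).

    The average vector field is handled through primitives
    ([antiderivative_unit]), so that estimates of integrals become mean value
    inequalities. *)

(** * Norm and exponential of matrices *)

(** Makes the absolute convergence criterion for series apply to matrices. *)
HB.instance Definition _ (R : realType) (m n : nat) :=
  Uniform_isComplete.Build 'M[R]_(m, n) (@mx_complete R m n).

Lemma subr_mxE {V : zmodType} m n (M N : 'M[V]_(m, n)) i j :
  (M - N) i j = M i j - N i j.
Proof. by rewrite !mxE. Qed.

Section MatrixNorm.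
Context {R : realType}.

Lemma normr_mx_le {m n} (M : 'M[R]_(m, n)) (c : R) : 0 <= c ->
  (forall i j, `|M i j| <= c) -> `|M| <= c.
Proof.
by move=> c0 Mc; rewrite /Num.Def.normr /= mx_normrE; apply: bigmax_le.
Qed.

Lemma normr_mx_ge {m n} (M : 'M[R]_(m, n)) i j : `|M i j| <= `|M|.
Proof.
rewrite [leRHS]/Num.Def.normr /= mx_normrE.
exact: (le_bigmax _ (fun ij => `|M ij.1 ij.2|) (i, j)).
Qed.

(** The norm of a matrix is the largest modulus of its entries, which is
    submultiplicative only up to the inner dimension; hence the scaled norm
    [d * |W|] that controls the powers of [W] below. *)
Lemma normr_mulmx_le {m n p} (M : 'M[R]_(m, n)) (N : 'M[R]_(n, p)) :
  `|M *m N| <= n%:R * (`|M| * `|N|).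
Proof.
apply: normr_mx_le => [|i j]; first by rewrite !mulr_ge0.
rewrite mxE (le_trans (ler_norm_sum _ _ _))//.
apply: (@le_trans _ _ (\sum_(k < n) `|M| * `|N|)); last first.
  by rewrite sumr_const card_ord mulr_natl.
by apply: ler_sum => k _; rewrite normrM ler_pM// normr_mx_ge.
Qed.

Lemma cvg_mx_entry {T : Type} (F : set_system T) {FF : Filter F} {m n}
    (f : T -> 'M[R]_(m, n)) (a : 'M[R]_(m, n)) i j :
  f @ F --> a -> (f t i j) @[t --> F] --> a i j.
Proof.
move=> fa; apply/cvgrPdist_le => e e0.
move: fa => /cvgrPdist_le /(_ _ e0); apply: filterS => t.
by apply: le_trans; have := normr_mx_ge (a - f t) i j; rewrite !mxE.
Qed.

Lemma cvg_mulmx {T : Type} (F : set_system T) {FF : Filter F} {m n p}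
    (f : T -> 'M[R]_(m, n)) (g : T -> 'M[R]_(n, p)) (a : 'M[R]_(m, n)) (b : 'M[R]_(n, p)) :
  f @ F --> a -> g @ F --> b -> (fun t => f t *m g t) @ F --> a *m b.
Proof.
move=> fa gb; apply: cvg_zero; apply: norm_cvg0.
apply: (@squeeze_cvgr _ _ _ _ (cst 0)
  (fun t => n%:R * (`|f t - a| * `|g t|) + n%:R * (`|a| * `|g t - b|))).
- near=> t; rewrite normr_ge0/=.
  rewrite [X in `|X|](_ : _ = (f t - a) *m g t + a *m (g t - b)); last first.
    by rewrite !fctE mulmxBl mulmxBr addrA subrK.
  by rewrite (le_trans (ler_normD _ _))// lerD// normr_mulmx_le.
- exact: cvg_cst.
- have /subr_cvg0/norm_cvg0P fa0 := fa; have /subr_cvg0/norm_cvg0P gb0 := gb.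
  have /= ga := cvg_norm gb.
  have -> : 0 = n%:R * (0 * `|b|) + n%:R * (`|a| * 0) :> R by ring.
  apply: cvgD; apply: cvgM; [exact: cvg_cst| |exact: cvg_cst|].
    by apply: cvgM; [exact: fa0|exact: ga].
  by apply: cvgM; [exact: cvg_cst|exact: gb0].
Unshelve. all: by end_near. Qed.

End MatrixNorm.

Section MatrixExponential.
Context {R : realType} {d : nat}.
Implicit Types (W Z A M : 'M[R]_d).

Local Notation expmx_sum W :=
  (series (fun n => (n`!%:R)^-1 *: (W : 'M[R]_d) ^+ n)).
Local Notation snorm W := (d%:R * `|W|).

Lemma normr_mx1_le : `|1 : 'M[R]_d| <= 1.
Proof.
apply: normr_mx_le => // i j; rewrite mxE; case: eqP => _ /=.
  by rewrite normr1.
by rewrite normr0.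
Qed.

Lemma normr_expmx_le W k : `|W ^+ k| <= snorm W ^+ k.
Proof.
elim: k => [|k IHk]; first by rewrite !expr0 normr_mx1_le.
rewrite exprS (le_trans (normr_mulmx_le _ _))// exprS mulrA.
by rewrite ler_wpM2l// mulr_ge0.
Qed.

Lemma normr_exp_term_le W k :
  `|(k`!%:R)^-1 *: W ^+ k| <= exp_coeff (snorm W) k.
Proof.
rewrite normrZ ger0_norm ?invr_ge0// mulrC.
by rewrite ler_wpM2r ?invr_ge0// normr_expmx_le.
Qed.

Lemma cvg_expmx W : expmx_sum W @ \oo --> expmx W.
Proof.
suff : cvgn [normed expmx_sum W] by exact: normed_cvg.
apply: series_le_cvg (is_cvg_series_exp_coeff (snorm W)).
- by move=> k; exact: normr_ge0.
- by move=> k; rewrite exp_coeff_ge0// mulr_ge0.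
- exact: normr_exp_term_le.
Qed.

(** The exponential series without its first two terms is bounded termwise by
    [w^2] times the series of [exp 1], because [1 / (k + 2)! <= 1 / k!] and
    [w <= 1]. *)
Lemma expmx_sub1_le W : snorm W <= 1 ->
  `|expmx W - 1 - W| <= expR 1 * snorm W ^+ 2.
Proof.
move=> w1; have w0 : 0 <= snorm W by rewrite mulr_ge0.
have cvgW : `|expmx_sum W n - 1 - W| @[n --> \oo] --> `|expmx W - 1 - W|.
  apply: cvg_norm; apply: cvgB; last exact: cvg_cst.
  by apply: cvgB; [exact: cvg_expmx|exact: cvg_cst].
rewrite -(cvg_lim _ cvgW)//; apply: limr_le.
  by apply/cvg_ex; eexists; exact: cvgW.
near=> n; have n2 : (2 <= n)%N by near: n; exact: nbhs_infty_ge.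
rewrite -(subnK n2) /series/= big_mkord !addnS addn0 !big_ord_recl/=.
rewrite expr0 expr1 !fact0 invr1 !scale1r [1 + _]addrC addrK.
rewrite [X in X - W]addrC addrK.
rewrite (le_trans (ler_norm_sum _ _ _))//.
have -> : expR 1 * snorm W ^+ 2 = snorm W ^+ 2 * expR 1 by rewrite mulrC.
apply: (@le_trans _ _ (snorm W ^+ 2 * series (exp_coeff (1 : R)) (n - 2)%N)).
  rewrite /series/= big_mkord mulr_sumr; apply: ler_sum => k _.
  rewrite (le_trans (normr_exp_term_le _ _))// /bump/= !add1n /exp_coeff/=.
  rewrite expr1n -addn2 exprD [_ ^+ k * _]mulrC -mulrA.
  rewrite ler_wpM2l ?sqr_ge0// ler_pM ?exprn_ge0 ?invr_ge0//.
    by rewrite exprn_ile1.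
  rewrite lef_pV2 ?posrE ?ltr0n ?fact_gt0// ler_nat.
  by rewrite addn2 !factS mulnA leq_pmull.
rewrite ler_wpM2l ?sqr_ge0//; apply: nondecreasing_cvgn_le.
  by apply: nondecreasing_series => k _ _; rewrite exp_coeff_ge0.
exact: is_cvg_series_exp_coeff.
Unshelve. all: by end_near. Qed.

End MatrixExponential.

Section MatrixExponentialSquare.
Context {R : realType}.
Local Notation expmx_sum W :=
  (series (fun n => (n`!%:R)^-1 *: W ^+ n)).

Lemma horner_mx_poly {d} (W : 'M[R]_d.+1) n (E : nat -> R) :
  horner_mx W (\poly_(k < n) E k) = \sum_(k < n) E k *: W ^+ k.
Proof.
rewrite poly_def rmorph_sum/=; apply: eq_bigr => k _.
by rewrite linearZ/= rmorphXn/= horner_mx_X.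
Qed.

(** Carries convergence of a sequence of scalar polynomials with nonnegative
    coefficients over to matrix arguments. *)
Lemma normr_horner_mx_le {d} (W : 'M[R]_d.+1) (p : {poly R}) :
  (forall k, 0 <= p`_k) -> `|horner_mx W p| <= p.[d.+1%:R * `|W|].
Proof.
move=> p0; rewrite -{1}(coefK p) horner_mx_poly horner_coef.
rewrite (le_trans (ler_norm_sum _ _ _))//; apply: ler_sum => k _.
by rewrite normrZ ger0_norm// ler_wpM2l// normr_expmx_le.
Qed.

Let exp_poly n : {poly R} := \poly_(k < n) (k`!%:R)^-1.
Let exp2_poly n : {poly R} := \poly_(k < n) (2 ^+ k / k`!%:R).

(** Below degree [n] the coefficients cancel, since the binomial coefficients of
    order [k] add up to [2^k]; above, the square only has nonnegative terms. *)
Lemma exp_poly_sqr_coef_ge0 n k : 0 <= (exp_poly n * exp_poly n - exp2_poly n)`_k.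
Proof.
rewrite coefB coefM coef_poly; case: ltnP => [kn|_]; last first.
  rewrite subr0 sumr_ge0// => i _.
  by apply: mulr_ge0; rewrite coef_poly; case: ifP => // _; rewrite invr_ge0.
have -> : 2 ^+ k = \sum_(i < k.+1) 'C(k, i)%:R :> R.
  rewrite -natrX -[2%N]/(1 + 1)%N Pascal natr_sum; apply: eq_bigr => i _.
  by rewrite !exp1n !muln1.
rewrite mulr_suml -sumrB.
rewrite big1// => i _; rewrite !coef_poly.
have ik : (i <= k)%N by rewrite -ltnS.
rewrite (leq_ltn_trans ik kn) (leq_ltn_trans (leq_subr _ _) kn).
rewrite -(bin_fact ik) !natrM.
have iF : (i`!%:R : R) != 0 by rewrite pnatr_eq0 -lt0n fact_gt0.
have kF : ((k - i)`!%:R : R) != 0 by rewrite pnatr_eq0 -lt0n fact_gt0.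
have bF : ('C(k, i)%:R : R) != 0 by rewrite pnatr_eq0 -lt0n bin_gt0.
by apply/eqP; rewrite subr_eq0; apply/eqP; field; rewrite iF kF bF.
Qed.

(** The difference between the squared partial sum at [W] and the partial sum at
    [2 W] is a polynomial with nonnegative coefficients, so its norm is at most
    its value at the scaled norm of [W]; that value tends to
    [exp w * exp w - exp (w + w) = 0]. *)
Lemma cvg_expmx_sqr d (W : 'M[R]_d) :
  expmx_sum W n *m expmx_sum W n @[n --> \oo] --> expmx (2 *: W).
Proof.
(* Polynomials are evaluated in the ring of matrices of positive dimension. *)
case: d W => [|d] W.
  rewrite [X in _ --> X]flatmx0.
  rewrite (_ : (fun n => _) = cst 0); first exact: cvg_cst.
  by apply/funext => n; rewrite flatmx0 [RHS]flatmx0.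
have expE n : expmx_sum W n = horner_mx W (exp_poly n).
  by rewrite /series/= big_mkord horner_mx_poly.
have exp2E n : expmx_sum (2 *: W) n = horner_mx W (exp2_poly n).
  rewrite /series/= big_mkord horner_mx_poly; apply: eq_bigr => k _.
  by rewrite exprZn scalerA mulrC.
set w := d.+1%:R * `|W|.
have exp_polyE n : (exp_poly n).[w] = series (exp_coeff w) n.
  rewrite horner_poly /series/= big_mkord; apply: eq_bigr => k _.
  by rewrite mulrC.
have exp2_polyE n : (exp2_poly n).[w] = series (exp_coeff (w + w)) n.
  rewrite horner_poly /series/= big_mkord; apply: eq_bigr => k _.
  by rewrite /exp_coeff/= -mulr2n -[w *+ 2]mulr_natl [in RHS]exprMn [LHS]mulrAC.
have cvgE := @cvg_expmx _ _ (2 *: W).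
apply: cvg_sub0 cvgE.
apply/norm_cvg0P.
apply: (@squeeze_cvgr _ _ _ _ (cst 0) (fun n =>
  series (exp_coeff w) n * series (exp_coeff w) n - series (exp_coeff (w + w)) n)).
- near=> n; rewrite normr_ge0/=.
  rewrite [X in `|X|](_ : _ = expmx_sum W n *m expmx_sum W n - expmx_sum (2 *: W) n)//.
  rewrite expE exp2E -[_ *m _]/(_ * _) -rmorphM -rmorphB.
  rewrite (le_trans (normr_horner_mx_le _ (exp_poly_sqr_coef_ge0 n)))//.
  by rewrite hornerD hornerN hornerM -/w exp_polyE exp2_polyE.
- exact: cvg_cst.
- have -> : 0 = expR w * expR w - expR (w + w) by rewrite expRD subrr.
  apply: cvgB; last exact: is_cvg_series_exp_coeff.
  by apply: cvgM; exact: is_cvg_series_exp_coeff.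
Unshelve. all: by end_near. Qed.

End MatrixExponentialSquare.

Section ExponentialPsd.
Context {R : realType} {d : nat}.
Implicit Types (W A M : 'M[R]_d).
Local Notation expmx_sum W :=
  (series (fun n => (n`!%:R)^-1 *: (W : 'M[R]_d) ^+ n)).

Lemma sym_psd_cvg (f : nat -> 'M[R]_d) M :
  (forall n, sym_psd (f n)) -> f @ \oo --> M -> sym_psd M.
Proof.
move=> fpsd fM; split.
  apply/matrixP => i j; rewrite mxE.
  apply: (@cvg_unique _ (@norm_hausdorff _ R) (f n i j @[n --> \oo])).
  - rewrite (_ : (fun n => f n i j) = (fun n => f n j i)).
      exact: cvg_mx_entry.
    by apply/funext => n; rewrite -{1}(fpsd n).1 mxE.
  - exact: cvg_mx_entry.
move=> v.
have /(@cvg_mx_entry _ _ _ _ _ _ _ _ 0 0) cvgv :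
    v^T *m f n *m v @[n --> \oo] --> v^T *m M *m v.
  by apply: cvg_mulmx; [apply: cvg_mulmx => //|]; exact: cvg_cst.
rewrite -(cvg_lim _ cvgv)//; apply: limr_ge.
  by apply/cvg_ex; eexists; exact: cvgv.
by apply: nearW => n; exact: (fpsd n).2.
Qed.

(** The hypothesis passes to powers and to partial sums [S] of the series of
    [exp W], so [S S A = S A S^T] is congruent to [A]; take the limit. *)
Lemma sym_psd_expmx W A : sym_psd A -> W *m A = A *m W^T ->
  sym_psd (expmx (2 *: W) *m A).
Proof.
move=> [At Apsd] WA.
have powWA k : W ^+ k *m A = A *m (W ^+ k)^T.
  elim: k => [|k IHk]; first by rewrite expr0 trmx1 mul1mx mulmx1.
  by rewrite {1}exprSr exprS -![_ * _]/(_ *m _) trmx_mul -mulmxA WA !mulmxA IHk.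
have sumWA n : expmx_sum W n *m A = A *m (expmx_sum W n)^T.
  rewrite /series/= mulmx_suml linear_sum/= mulmx_sumr.
  by apply: eq_bigr => k _; rewrite linearZ/= -scalemxAl -scalemxAr powWA.
apply: (@sym_psd_cvg (fun n => expmx_sum W n *m expmx_sum W n *m A)).
  move=> n; rewrite -mulmxA sumWA mulmxA; split.
    by rewrite !trmx_mul trmxK At mulmxA.
  move=> v; have := Apsd ((expmx_sum W n)^T *m v).
  by rewrite trmx_mul trmxK !mulmxA.
by apply: cvg_mulmx; [exact: cvg_expmx_sqr|exact: cvg_cst].
Qed.
End ExponentialPsd.

(** * Functions of class C^k along segments *)

Lemma near_eq_differentiable {R : realType} {V W : normedModType R}
    (F G : V -> W) (x : V) :
  {near x, F =1 G} -> differentiable F x -> differentiable G x.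
Proof.
move=> FG dF; have [cdF FE] := (diff_locallyP _ _).1 dF.
suff GE : G \o shift x = cst (G x) + 'd F x +o_ 0 id.
  by apply/diff_locallyP; rewrite (diff_unique cdF GE).
apply/eqaddoP => e e0; move/eqaddoP: FE => /(_ _ e0).
have FG0 : \forall h \near 0, F (h + x) = G (h + x).
  by move: FG; rewrite (near_shift 0)/= subr0.
apply: filterS2 FG0 => h /=.
rewrite !fctE/= => ->.
by rewrite (nbhs_singleton FG).
Qed.

(** Continuity is assumed up to the end points, differentiability inside: this is
    the regularity of an exact solution on a step. *)
Lemma derivative_bound {R : realType} (f df : R -> R) (a b M : R) :
  {within `[a, b], continuous f} ->
  (forall t, a < t < b -> is_derive t 1 f (df t)) ->
  (forall t, a < t < b -> `|df t| <= M) ->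
  forall s t, a <= s <= b -> a <= t <= b -> `|f t - f s| <= M * `|t - s|.
Proof.
move=> cf f' dfM.
have main s t : a <= s -> t <= b -> s < t -> `|f t - f s| <= M * `|t - s|.
  move=> sa tb st.
  have [u|u|c] := @MVT R f df s t st.
  - rewrite in_itv/= => /andP[su ut]; apply: f'.
    by rewrite (le_lt_trans sa su) (lt_le_trans ut tb).
  - by apply/(continuous_subspaceW _ cf)/subset_itv; rewrite bnd_simp.
  rewrite in_itv/= => /andP[sc ct] ->; rewrite normrM ler_wpM2r//.
  by apply: dfM; rewrite (le_lt_trans sa sc) (lt_le_trans ct tb).
move=> s t /andP[sa sb] /andP[ta tb]; case: (ltgtP s t) => [st|ts|->].
- exact: main.
- by rewrite distrC (distrC t); exact: main.
- by rewrite !subrr normr0 mulr0.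
Qed.

Lemma open_itv01W {R : realType} (t : R) : 0 < t < 1 -> 0 <= t <= 1.
Proof. by move=> /andP[/ltW-> /ltW->]. Qed.

Lemma is_derive_linear {R : realType} (c t : R) :
  is_derive t 1 (fun xi : R => xi * c) c.
Proof.
rewrite -[X in is_derive _ _ _ X]mulr1.
rewrite (_ : (fun _ => _) = c \*: (id : R -> R)).
  exact: is_deriveZ.
by apply/funext => xi; rewrite /= mulrC.
Qed.

Lemma near_values_close {R : realType} (e b1 b2 b3 b4 : R) :
  `|b1 - b2| <= e / 2 -> `|b3 - b4| <= e / 2 -> b4 = b2 -> `|b1 - b3| <= e.
Proof.
move=> b12 b34 b42; rewrite -(subrKA b2) [e]splitr.
by rewrite (le_trans (ler_normD _ _))// lerD// -b42 distrC.
Qed.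

Section SmoothFunctions.
Context {R : realType} {d : nat}.
Implicit Types (X : set 'cV[R]_d) (F G : 'cV[R]_d -> R) (x y : 'cV[R]_d).

Lemma partial_ext X F G x i : open X -> X x -> (forall y, X y -> F y = G y) ->
  partial i F x = partial i G x.
Proof.
move=> oX Xx FG; apply: near_eq_derive.
by apply: filterS (open_nbhs_nbhs (conj oX Xx)) => y /FG.
Qed.

(** The rules of differentiation give the partial derivatives of a sum or of a
    product on [X] only, so smoothness has to be insensitive to the values
    outside [X]. *)
Lemma class_C_ext k X F G : open X -> (forall x, X x -> F x = G x) ->
  class_C k X F -> class_C k X G.
Proof.
move=> oX; elim: k F G => [|k IHk] F G FG /=.
  move=> cF x Xx; have nFG : {near x, F =1 G}.
    by apply: filterS (open_nbhs_nbhs (conj oX Xx)) => y /FG.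
  rewrite /prop_for /continuous_at -(FG _ Xx).
  exact: cvg_trans (near_eq_cvg nFG) (cF _ Xx).
move=> [dF CF]; split.
  move=> x Xx; apply: near_eq_differentiable (dF _ Xx).
  by apply: filterS (open_nbhs_nbhs (conj oX Xx)) => y /FG.
move=> i; apply: (IHk (partial i F)) (CF i) => x Xx; exact: (partial_ext i oX Xx FG).
Qed.

Lemma class_CS k X F : class_C k.+1 X F -> class_C k X F.
Proof.
elim: k F => [|k IHk] F /= [dF CF].
  by move=> x Xx; apply: differentiable_continuous; exact: dF.
by split => // i; apply: IHk; exact: CF.
Qed.

Lemma class_C_le k l X F : (k <= l)%N -> class_C l X F -> class_C k X F.
Proof.
move=> /subnK <-; elim: (l - k)%N => [//|n IHn]; rewrite addSn => CF.
exact/IHn/class_CS.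
Qed.

Lemma class_C_continuous k X F x : class_C k X F -> X x -> {for x, continuous F}.
Proof. by move=> CF; apply: (@class_C_le 0%N k X F) CF x. Qed.

Lemma class_C_cst k X c : class_C k X (fun=> c).
Proof.
elim: k c => [|k IHk] c /=; first by move=> x _; exact: cst_continuous.
split=> [x _|i]; first exact: differentiable_cst.
rewrite (_ : partial i _ = fun=> 0); first exact: IHk.
by apply/funext => x; exact: derive_cst.
Qed.

Lemma class_CD k X F G : open X -> class_C k X F -> class_C k X G ->
  class_C k X (fun x => F x + G x).
Proof.
move=> oX; elim: k F G => [|k IHk] F G /=.
  by move=> cF cG x Xx; apply: continuousD; [exact: cF|exact: cG].
move=> [dF CF] [dG CG]; split=> [x Xx|i].
  by apply: differentiableD; [exact: dF|exact: dG].
apply: class_C_ext (IHk _ _ (CF i) (CG i)) => // x Xx.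
by rewrite /partial deriveD//; apply/diff_derivable; [exact: dF|exact: dG].
Qed.

Lemma class_CM k X F G : open X -> class_C k X F -> class_C k X G ->
  class_C k X (fun x => F x * G x).
Proof.
move=> oX; elim: k F G => [|k IHk] F G.
  by move=> cF cG x Xx; apply: continuousM; [exact: cF|exact: cG].
move=> CF CG; have [dF pF] := CF; have [dG pG] := CG; split=> [x Xx|i].
  by apply: differentiableM; [exact: dF|exact: dG].
apply: (class_C_ext (F := fun x => F x * partial i G x + G x * partial i F x)) => //.
  by move=> x Xx; rewrite /partial deriveM//; apply/diff_derivable; [exact: dF|exact: dG].
apply: class_CD => //; apply: IHk;
  first [exact: class_CS CF|exact: class_CS CG|exact: pF|exact: pG].
Qed.

Lemma class_C_sum k X n (F : 'I_n -> 'cV[R]_d -> R) : open X ->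
  (forall i, class_C k X (F i)) -> class_C k X (fun x => \sum_(i < n) F i x).
Proof.
move=> oX; elim: n F => [|n IHn] F CF.
  by under eq_fun do rewrite big_ord0; exact: class_C_cst.
under eq_fun do rewrite big_ord_recr/=.
by apply: class_CD => //; apply: IHn.
Qed.

Lemma partial_coord i j z :
  partial i (fun z' : 'cV[R]_d => z' j 0) z = (delta_mx i 0 : 'cV[R]_d) j 0.
Proof.
rewrite /partial.
have /matrixP /(_ j 0) := derive_mx (@derivable_id R 'cV[R]_d z (delta_mx i 0)).
by rewrite derive_id [RHS]mxE => <-.
Qed.

Lemma class_C_coord k X j : class_C k X (fun x => x j 0).
Proof.
case: k => [|k]; first by move=> x _; exact: coord_continuous.
split=> [x _|i]; first exact: differentiable_coord.
rewrite (_ : partial i _ = fun=> (delta_mx i 0 : 'cV[R]_d) j 0).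
  exact: class_C_cst.
by apply/funext => x; exact: partial_coord.
Qed.

Lemma is_derive_comp_curve F (gamma : R -> 'cV[R]_d) t (v : 'cV[R]_d) :
  differentiable F (gamma t) -> is_derive t 1 gamma v ->
  is_derive t 1 (F \o gamma) (\sum_i partial i F (gamma t) * v i 0).
Proof.
move=> dF dg; have dg' : differentiable gamma t.
  by apply/derivable1_diffP; exact: ex_derive.
have dFg := differentiable_comp dg' dF.
apply: DeriveDef; first exact: diff_derivable.
have dgv : 'd gamma t 1 = v by rewrite -deriveE//; case: dg.
rewrite deriveE// diff_comp//= dgv.
rewrite [in LHS](matrix_sum_delta v) linear_sum; apply: eq_bigr => i _.
rewrite big_ord1 linearZ/= /partial deriveE// mulrC.
by congr (_ * _).
Qed.

Lemma is_derive_segment x y (t : R) :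
  is_derive t 1 (fun xi : R => (1 - xi) *: x + xi *: y) (y - x).
Proof.
rewrite (_ : (fun _ => _) = (fun xi : R => x + xi *: (y - x))); last first.
  by apply/funext => xi; rewrite scalerBl scale1r scalerBr addrAC addrA.
rewrite -[X in is_derive _ _ _ X]add0r.
apply: (@is_deriveD _ _ _ (cst x) (fun xi : R => xi *: (y - x))).
have dZ := @differentiableZl _ _ _ id (y - x) t (@ex_diff _ _ _ _ _ _ _ (is_diff_id t)).
apply: DeriveDef; first exact: diff_derivable.
by rewrite deriveE// diffZl// diff_val scale1r.
Qed.

Lemma segment_in_ball x0 r x y : ball x0 r x -> ball x0 r y ->
  segment_in (ball x0 r) x y.
Proof.
rewrite -!ball_normE/= => xr yr xi /andP[xi0 xi1]. rewrite /ball_/=.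
rewrite (_ : x0 - _ = (1 - xi) *: (x0 - x) + xi *: (x0 - y)); last first.
  rewrite !scalerBr addrACA -scalerDl subrK scale1r opprD//.
rewrite (le_lt_trans (ler_normD _ _))// !normrZ !ger0_norm ?subr_ge0//.
rewrite (_ : r = (1 - xi) * r + xi * r); last by rewrite -mulrDl subrK mul1r.
move: xi0; rewrite le_eqVlt => /predU1P[<-|xi0].
  by rewrite !mul0r !addr0 subr0 !mul1r.
by rewrite ler_ltD// ?ltr_pM2l// ler_wpM2l ?subr_ge0// ltW.
Qed.

Lemma segment_in_sub X Y x y : X `<=` Y -> segment_in X x y -> segment_in Y x y.
Proof. by move=> XY + xi /[dup] ? => /[apply]; exact: XY. Qed.

Lemma is_derive_along_segment F x y (t : R) :
  differentiable F ((1 - t) *: x + t *: y) ->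
  is_derive t 1 (fun xi : R => F ((1 - xi) *: x + xi *: y))
    (\sum_i partial i F ((1 - t) *: x + t *: y) * (y - x) i 0).
Proof.
move=> dF.
exact: (@is_derive_comp_curve F (fun xi : R => (1 - xi) *: x + xi *: y) t _ dF
  (is_derive_segment _ _ _)).
Qed.

Lemma continuous_along_segment X F x y : (forall z, X z -> differentiable F z) ->
  segment_in X x y ->
  {within `[0, 1], continuous (fun xi : R => F ((1 - xi) *: x + xi *: y))}.
Proof.
move=> dF Xxy; apply: derivable_within_continuous => t; rewrite in_itv/= => t01.
by have [] := is_derive_along_segment (dF _ (Xxy _ t01)).
Qed.

Lemma sum_partial_le (c : 'I_d -> R) (K : R) (v : 'cV[R]_d) : 0 <= K ->
  (forall i, `|c i| <= K) -> `|\sum_i c i * v i 0| <= d%:R * (K * `|v|).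
Proof.
move=> K0 cK; rewrite (le_trans (ler_norm_sum _ _ _))//.
apply: (@le_trans _ _ (\sum_(i < d) K * `|v|)).
  by apply: ler_sum => i _; rewrite normrM ler_pM// normr_mx_ge.
by rewrite sumr_const card_ord mulr_natl.
Qed.

Lemma lipschitz_on_segment X F x y (K : R) : 0 <= K -> segment_in X x y ->
  (forall z, X z -> differentiable F z) ->
  (forall z i, X z -> `|partial i F z| <= K) ->
  `|F y - F x| <= d%:R * (K * `|y - x|).
Proof.
move=> K0 Xxy dF pFK.
have := @derivative_bound R _ _ 0 1 (d%:R * (K * `|y - x|))
  (continuous_along_segment dF Xxy)
  (fun t t01 => is_derive_along_segment (dF _ (Xxy t (open_itv01W t01)))) _ 0 1.
rewrite !subr0 !scale1r !scale0r subrr !scale0r addr0 add0r normr1 mulr1.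
apply; rewrite ?lexx ?ler01// => t t01; apply: sum_partial_le => // i.
exact/pFK/Xxy/open_itv01W.
Qed.

(** Subtract the linear part along the segment: the derivative of the remainder is
    an increment of the first partials, which is bounded by
    [lipschitz_on_segment]. *)
Lemma taylor2_on_segment X F x y (K : R) : 0 <= K -> segment_in X x y ->
  (forall z, X z -> differentiable F z) ->
  (forall z i, X z -> differentiable (partial i F) z) ->
  (forall z i j, X z -> `|partial j (partial i F) z| <= K) ->
  `|F y - F x - \sum_i partial i F x * (y - x) i 0|
    <= (d%:R * d%:R * K) * `|y - x| ^+ 2.
Proof.
move=> K0 Xxy dF dpF pFK.
set c := fun i => partial i F x.
pose g (xi : R) := F ((1 - xi) *: x + xi *: y) - xi * \sum_i c i * (y - x) i 0.
have dg (t : R) : 0 <= t <= 1 -> is_derive t 1 g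
   (\sum_i (partial i F ((1 - t) *: x + t *: y) - c i) * (y - x) i 0).
  move=> t01; have ? := is_derive_along_segment (dF _ (Xxy _ t01)).
  have -> : \sum_i (partial i F ((1 - t) *: x + t *: y) - c i) * (y - x) i 0 =
     \sum_i (partial i F ((1 - t) *: x + t *: y)) * (y - x) i 0 -
     (\sum_i c i * (y - x) i 0).
    by rewrite -sumrB; apply: eq_bigr => i _; rewrite mulrBl.
  apply: is_deriveB; exact: is_derive_linear.
have cg : {within `[0, 1], continuous g}.
  apply: derivable_within_continuous => t; rewrite in_itv/= => t01.
  by have [] := dg _ t01.
have := @derivative_bound R g _ 0 1 (d%:R * (d%:R * (K * `|y - x|) * `|y - x|)) cg
  (fun t t01 => dg t (open_itv01W t01)) _ 0 1.
rewrite /g !subr0 !scale1r !scale0r subrr !scale0r mul0r subr0 addr0 add0r normr1 mulr1 mul1r.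
rewrite addrAC.
rewrite (_ : d%:R * d%:R * K * `|y - x| ^+ 2 =
  d%:R * (d%:R * (K * `|y - x|) * `|y - x|)); last by ring.
apply; rewrite ?lexx ?ler01//.
move=> t /open_itv01W t01; apply: sum_partial_le => [|i]; first by rewrite !mulr_ge0.
have Xxt : segment_in X x ((1 - t) *: x + t *: y).
  move=> u u01; rewrite (_ : _ + _ = (1 - u * t) *: x + (u * t) *: y).
    apply: Xxy; move: t01 u01 => /andP[t0 t1] /andP[u0 u1].
    by rewrite mulr_ge0//= mulr_ile1.
  rewrite scalerDr !scalerA addrA -scalerDl; congr (_ *: _ + _); ring.
rewrite (le_trans (lipschitz_on_segment K0 Xxt (fun z => dpF z i) (fun z j => pFK z i j)))//.
rewrite ler_wpM2l// ler_wpM2l//.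
rewrite (_ : _ - x = t *: (y - x)).
  move: t01 => /andP[t0 t1].
  by rewrite normrZ ger0_norm// ler_piMl.
by rewrite scalerBl scale1r scalerBr addrAC [x - _]addrC addrK addrC.
Qed.

Lemma sum_coord_delta (c : 'I_d -> R) i (h : R) :
  \sum_k c k * (h *: delta_mx i 0 : 'cV[R]_d) k 0 = h * c i.
Proof.
rewrite (bigD1 i)//= big1 => [|k ki]; last by rewrite !mxE (negbTE ki) !mulr0.
by rewrite !mxE !eqxx mulr1 addr0 mulrC.
Qed.

(** Two mean values, in direction [i] and then in direction [j].  Exchanging [i]
    and [j] does not change the left-hand side. *)
Lemma second_difference (i j : 'I_d) X (H : 'cV[R]_d -> R) (a : 'cV[R]_d) (h : R) : 0 < h ->
  ball a (3 * h) `<=` X ->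
  (forall z, X z -> differentiable H z) ->
  (forall z, X z -> differentiable (partial i H) z) ->
  exists2 p, ball a (3 * h) p &
  H (a + h *: delta_mx i 0 + h *: delta_mx j 0) - H (a + h *: delta_mx j 0)
   - (H (a + h *: delta_mx i 0) - H a) = h ^+ 2 * partial j (partial i H) p.
Proof.
move=> h0 bX dH dHi.
set u := h *: delta_mx i 0; set v := h *: delta_mx j 0.
have norm_delta k : `|h *: delta_mx k 0 : 'cV[R]_d| <= h.
  rewrite normrZ gtr0_norm// ler_piMr ?(ltW h0)//.
  by apply: normr_mx_le => // k' l; rewrite mxE; case: (_ && _); rewrite ?normr1 ?normr0.
have inb (s t : R) : 0 <= s <= 1 -> 0 <= t <= 1 -> ball a (3 * h) (a + s *: u + t *: v).
  move=> /andP[s0 s1] /andP[t0 t1]; rewrite -ball_normE/= /ball_/= -addrA.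
  rewrite opprD addrA subrr add0r normrN.
  rewrite (le_lt_trans (ler_normD _ _))//.
  have su : s * `|u| <= 1 * h by exact: ler_pM s0 (normr_ge0 _) s1 (norm_delta i).
  have tv : t * `|v| <= 1 * h by exact: ler_pM t0 (normr_ge0 _) t1 (norm_delta j).
  rewrite (normrZ s u) (normrZ t v) (ger0_norm s0) (ger0_norm t0).
  by rewrite (le_lt_trans (lerD su tv))//; lra.
have seg (x w : 'cV[R]_d) (s : R) : (1 - s) *: x + s *: (x + w) = x + s *: w.
  by rewrite scalerDr addrA -scalerDl subrK scale1r.
pose phi (s : R) :=
  H ((1 - s) *: (a + v) + s *: (a + v + u)) - H ((1 - s) *: a + s *: (a + u)).
have EH P : h * partial i H P = \sum_k partial k H P * u k 0.
  by rewrite (sum_coord_delta (fun k => partial k H P)).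
have dphi (s : R) : 0 <= s <= 1 -> is_derive s 1 phi
    (h * (partial i H (a + s *: u + v) - partial i H (a + s *: u))).
  move=> s01; rewrite mulrBr !EH.
  apply: is_deriveB.
    have := @is_derive_along_segment H (a + v) (a + v + u) s.
    rewrite [a + v + u - _]addrC addKr seg [a + v + _]addrAC; apply.
    by apply/dH/bX; rewrite -[v in a + _ + v]scale1r; apply: inb; rewrite // ler01 lexx.
  have := @is_derive_along_segment H a (a + u) s.
  rewrite [a + u - _]addrC addKr seg; apply.
  by apply/dH/bX; rewrite -[X in ball _ _ X]addr0 -(scale0r v); apply: inb;
    rewrite // ler01 lexx.
have [s||s sI Es] := @MVT R phi
  (fun s => h * (partial i H (a + s *: u + v) - partial i H (a + s *: u))) 0 1 ltr01.
- by rewrite in_itv/= => /open_itv01W; exact: dphi.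
- apply: derivable_within_continuous => s; rewrite in_itv/= => s01.
  by have [] := dphi s s01.
have {sI} s01 : 0 <= s <= 1 by move: sI; rewrite in_itv/= => /open_itv01W.
have EHi P : h * partial j (partial i H) P = \sum_k partial k (partial i H) P * v k 0.
  by rewrite (sum_coord_delta (fun k => partial k (partial i H) P)).
pose psi (t : R) := partial i H ((1 - t) *: (a + s *: u) + t *: (a + s *: u + v)).
have dpsi (t : R) : 0 <= t <= 1 -> is_derive t 1 psi
    (h * partial j (partial i H) (a + s *: u + t *: v)).
  move=> t01; rewrite EHi.
  have := @is_derive_along_segment (partial i H) (a + s *: u) (a + s *: u + v) t.
  rewrite [a + _ + v - _]addrC addKr seg; apply.
  by apply/dHi/bX/inb.
have [t||t tI Et] := @MVT R psi
  (fun t => h * partial j (partial i H) (a + s *: u + t *: v)) 0 1 ltr01.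
- by rewrite in_itv/= => /open_itv01W; exact: dpsi.
- apply: derivable_within_continuous => t; rewrite in_itv/= => t01.
  by have [] := dpsi t t01.
have {tI} t01 : 0 <= t <= 1 by move: tI; rewrite in_itv/= => /open_itv01W.
exists (a + s *: u + t *: v); first exact: inb.
move: Es Et; rewrite /phi /psi !seg !scale1r !scale0r !addr0 !subr0 !mulr1 => Es Et.
rewrite [a + u + v]addrAC (_ : _ - _ = H (a + v + u) - H (a + u) - (H (a + v) - H a)).
  by rewrite Es Et; ring.
by ring.
Qed.

(** Evaluating the same second difference in both orders yields points [p] and
    [q], arbitrarily close to [a], where the two mixed derivatives agree; both are
    continuous at [a]. *)
Lemma hessian_sym X H a : open X -> class_C 2 X H -> X a ->
  (hessian H a)^T = hessian H a.
Proof.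
move=> oX [dH CH] Xa; apply/matrixP => i j; rewrite !mxE.
have [dHi _] := CH i; have [dHj _] := CH j.
have c1 := (CH j).2 i a Xa.
have c2 := (CH i).2 j a Xa.
apply/eqP; rewrite -subr_eq0 -normr_le0; apply/ler_addgt0Pl => e e0; rewrite addr0.
have e20 : 0 < e / 2 by rewrite divr_gt0.
have n1 : \forall z \near a,
    `|partial i (partial j H) a - partial i (partial j H) z| <= e / 2.
  by move/cvgrPdist_le : c1 => /(_ _ e20).
have n2 : \forall z \near a,
    `|partial j (partial i H) a - partial j (partial i H) z| <= e / 2.
  by move/cvgrPdist_le : c2 => /(_ _ e20).
have n3 : \forall z \near a, X z by exact: open_nbhs_nbhs.
have /nbhs_ballP [r /= r0 rb] : \forall z \near a,
    [/\ `|partial i (partial j H) a - partial i (partial j H) z| <= e / 2,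
        `|partial j (partial i H) a - partial j (partial i H) z| <= e / 2 & X z].
  by apply: filterS3 n1 n2 n3 => z; split.
have h0 : 0 < r / 3 by rewrite divr_gt0.
have rE : 3 * (r / 3) = r by rewrite mulrC divfK.
have rX : ball a (3 * (r / 3)) `<=` X by rewrite rE => z /rb[].
have [p] := second_difference j h0 rX dH dHi.
rewrite rE => /rb[/= _ p2 _] Ep.
have [q] := second_difference i h0 rX dH dHj.
rewrite rE => /rb[/= q1 _ _] Eq.
have aux (b1 b2 b3 b4 : R) : b1 - b2 - (b3 - b4) = b1 - b3 - (b2 - b4) by ring.
have pq : partial j (partial i H) p = partial i (partial j H) q.
  have h20 : (r / 3) ^+ 2 != 0 by rewrite expf_neq0// gt_eqF.
  apply: (mulfI h20); apply: etrans (esym Ep) _; apply: etrans Eq.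
  by rewrite [a + _ *: delta_mx j 0 + _]addrAC aux.
exact: near_values_close p2 q1 (esym pq).
Qed.
End SmoothFunctions.

(** * The average vector field and the energy balance *)

Section AverageVectorField.
Context {R : realType}.

(** All that is used of the integral: it is the increment of a primitive, to which
    [derivative_bound] applies. *)
Lemma antiderivative_unit (f : R -> R) : {within `[0, 1], continuous f} ->
  exists F : R -> R, [/\ {within `[0, 1], continuous F},
    forall t : R, 0 < t < 1 -> is_derive t 1 F (f t) &
    F 1 - F 0 = \int[lebesgue_measure]_(t in `[0, 1]) f t].
Proof.
move=> cf; have intf : lebesgue_measure.-integrable `[0, 1] (EFin \o f).
  by apply: continuous_compact_integrable => //; exact: segment_compact.
exists (fun x => parameterized_integral lebesgue_measure 0 x f); split.
- exact: parameterized_integral_continuous.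
- move=> t /andP[t0 t1].
  have [cf' _ _] := (continuous_within_itvP f ltr01).1 cf.
  have [] := continuous_FTC1_closed t1 intf t0 (cf' t _).
    by rewrite in_itv/= t0.
  by move=> dF <-; rewrite derive1E; exact: derivableP.
- by rewrite /parameterized_integral set_itv1 Rintegral_set1 subr0.
Qed.

Lemma within_continuous_sum (A : set R) n (f : 'I_n -> R -> R) :
  (forall i, {within A, continuous (f i)}) ->
  {within A, continuous (fun t => \sum_i f i t)}.
Proof.
elim: n f => [|n IHn] f cf.
  by under eq_fun do rewrite big_ord0; move=> x; exact: cvg_cst.
under eq_fun do rewrite big_ord_recr/=.
by move=> x; apply: continuousD; [apply: IHn => i; exact: cf|exact: cf].
Qed.

Lemma within_continuous_add (S : set R) (f g : R -> R) :
  {within S, continuous f} -> {within S, continuous g} ->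
  {within S, continuous (fun r => f r + g r)}.
Proof. by move=> cf cg r; apply: continuousD; [exact: cf|exact: cg]. Qed.

Lemma within_continuous_mulr (S : set R) (f : R -> R) (c : R) :
  {within S, continuous f} -> {within S, continuous (fun r => f r * c)}.
Proof. by move=> cf r; apply: continuousM; [exact: cf|exact: cvg_cst]. Qed.

Lemma is_derive_sum_fun n (f : 'I_n -> R -> R) (df : 'I_n -> R) (t : R) :
  (forall i, is_derive t 1 (f i) (df i)) ->
  is_derive t 1 (fun s => \sum_i f i s) (\sum_i df i).
Proof.
move=> dfi; rewrite (_ : (fun _ => _) = \sum_i f i); last first.
  by apply/funext => s; rewrite fct_sumE.
exact: is_derive_sum.
Qed.

Lemma is_derive_mulr_cst (f : R -> R) (df c t : R) :
  is_derive t 1 f df -> is_derive t 1 (fun s => f s * c) (df * c).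
Proof.
move=> dft; rewrite (_ : (fun _ => _) = c \*: f); last first.
  by apply/funext => s; rewrite /= mulrC.
by rewrite mulrC; exact: is_deriveZ.
Qed.

Context {d : nat}.
Implicit Types (X : set 'cV[R]_d) (H : 'cV[R]_d -> R) (x y : 'cV[R]_d).

Lemma gradE H x i : grad H x i 0 = partial i H x.
Proof. by rewrite mxE. Qed.

Lemma avf_antiderivative X H x y : class_C 2 X H -> segment_in X x y ->
  exists F : 'I_d -> R -> R, forall i, [/\ {within `[0, 1], continuous (F i)},
    forall t : R, 0 < t < 1 ->
      is_derive t 1 (F i) (grad H ((1 - t) *: x + t *: y) i 0) &
    F i 1 - F i 0 = avf H x y i 0].
Proof.
move=> [dH CH] Xxy.
suff /choice[F FP] : forall i, exists F : R -> R,
    [/\ {within `[0, 1], continuous F},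
    forall t : R, 0 < t < 1 ->
      is_derive t 1 F (grad H ((1 - t) *: x + t *: y) i 0) &
    F 1 - F 0 = avf H x y i 0] by exists F.
move=> i.
have cg : {within `[0, 1], continuous (fun t : R =>
    grad H ((1 - t) *: x + t *: y) i 0)}.
  have [dHi _] := CH i.
  rewrite (_ : (fun _ => _) =
      (fun t : R => partial i H ((1 - t) *: x + t *: y))).
    exact: continuous_along_segment Xxy.
  by apply/funext => t; rewrite gradE.
have [F [cF dF EF]] := antiderivative_unit cg.
by exists F; split=> //; rewrite EF mxE.
Qed.

(** If [F i] is a primitive of the [i]-th component of the gradient along the
    segment, then [H] along the segment minus the sum of the [F i] weighted by
    [y - x] has derivative zero. *)
Lemma energy_identity X H x y : class_C 2 X H -> segment_in X x y ->
  H y - H x = ((avf H x y)^T *m (y - x)) 0 0.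
Proof.
move=> CH Xxy; have [F FP] := avf_antiderivative CH Xxy.
pose g t := H ((1 - t) *: x + t *: y) - \sum_i F i t * (y - x) i 0.
have cg : {within `[0, 1], continuous g}.
  move=> t; apply: continuousB; first exact: (continuous_along_segment CH.1 Xxy).
  apply: within_continuous_sum => i {}t; apply: continuousM; last exact: cvg_cst.
  by have [+ _ _] := FP i; exact.
have dg (t : R) : 0 < t < 1 -> is_derive t 1 g (cst 0 t).
  move=> t01; rewrite /cst (_ : 0 = \sum_i partial i H ((1 - t) *: x + t *: y) * (y - x) i 0
    - \sum_i partial i H ((1 - t) *: x + t *: y) * (y - x) i 0); last by rewrite subrr.
  apply: is_deriveB; first by apply/is_derive_along_segment/CH.1/Xxy/open_itv01W.
  apply: is_derive_sum_fun => i.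
  have [_ + _] := FP i => /(_ t t01); rewrite gradE => dF.
  exact: is_derive_mulr_cst.
have := @derivative_bound R g (cst 0) 0 1 0 cg dg _ 0 1.
rewrite mul0r /g !subr0 subrr !scale1r !scale0r addr0 add0r ?lexx ?ler01.
move=> /(_ _ isT isT) g01; have {g01} : `|H y - \sum_i F i 1 * (y - x) i 0 -
    (H x - \sum_i F i 0 * (y - x) i 0)| <= 0.
  by apply: g01 => t _; rewrite /cst normr0.
rewrite normr_le0 subr_eq0 => /eqP g01.
rewrite mxE (_ : \sum__ _ = \sum_i F i 1 * (y - x) i 0 - \sum_i F i 0 * (y - x) i 0).
  have aux (a b c e : R) : a - c = b - e -> a - b = c - e by move=> E; lra.
  exact: aux g01.
by rewrite -sumrB; apply: eq_bigr => i _; have [_ _ E] := FP i; rewrite mxE -E mulrBl.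
Qed.

Lemma dissipation_le0 X H x y (M : 'M[R]_d) (h : R) : class_C 2 X H ->
  segment_in X x y -> sym_psd M -> 0 < h ->
  h^-1 *: (y - x) = - (M *m avf H x y) -> H y - H x <= 0.
Proof.
move=> CH Xxy [_ Mpsd] h0 E; rewrite (energy_identity CH Xxy).
have -> : y - x = - (h *: (M *m avf H x y)).
  by rewrite -scalerN -E scalerA mulfV ?gt_eqF// scale1r.
rewrite mulmxN mxE oppr_le0 -scalemxAr mxE mulr_ge0 ?(ltW h0)//.
by rewrite mulmxA; exact: Mpsd.
Qed.
End AverageVectorField.

(** * Domination along a filter *)

Section Dominated.
Context {R : realType} {T : Type} (F : set_system T) {FF : Filter F}.
Implicit Types (k : T -> R).

(** The constant is nonnegative so that the bound survives replacing [k] by a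
    larger function. *)
Definition dominated {V : normedModType R} k (u : T -> V) : Prop :=
  exists2 C : R, 0 <= C & \forall t \near F, `|u t| <= C * k t.

Lemma dominated_near {V W : normedModType R} k k' (u : T -> V) (v : T -> W) :
  (\forall t \near F, `|v t| <= `|u t|) ->
  (\forall t \near F, k t <= k' t) -> dominated k u -> dominated k' v.
Proof.
move=> vu kk' [C C0 uC]; exists C => //; apply: filterS3 vu kk' uC => t vut kt ut.
by rewrite (le_trans vut)// (le_trans ut)// ler_wpM2l.
Qed.

Lemma dominated_le {V : normedModType R} k k' (u : T -> V) :
  (\forall t \near F, k t <= k' t) -> dominated k u -> dominated k' u.
Proof. by apply: dominated_near; apply: nearW. Qed.

Lemma dominated_eq {V : normedModType R} k (u v : T -> V) :
  (\forall t \near F, u t = v t) -> dominated k u -> dominated k v.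
Proof.
by move=> uv; apply: dominated_near; [apply: filterS uv => t ->|apply: nearW].
Qed.

Lemma dominatedD {V : normedModType R} k (u v : T -> V) :
  dominated k u -> dominated k v -> dominated k (fun t => u t + v t).
Proof.
move=> [C C0 uC] [D D0 vD]; exists (C + D); first exact: addr_ge0.
apply: filterS2 uC vD => t ut vt; rewrite mulrDl.
by rewrite (le_trans (ler_normD _ _))// lerD.
Qed.

Lemma dominatedN {V : normedModType R} k (u : T -> V) :
  dominated k u -> dominated k (fun t => - u t).
Proof. by move=> [C C0 uC]; exists C => //; apply: filterS uC => t; rewrite normrN. Qed.

Lemma dominatedB {V : normedModType R} k (u v : T -> V) :
  dominated k u -> dominated k v -> dominated k (fun t => u t - v t).
Proof. by move=> ? /dominatedN; exact: dominatedD. Qed.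

Lemma dominatedZ {V : normedModType R} k k' (a : T -> R) (u : T -> V) :
  dominated k a -> dominated k' u -> dominated (k \* k') (fun t => a t *: u t).
Proof.
move=> [C C0 uC] [D D0 vD]; exists (C * D); first exact: mulr_ge0.
apply: filterS2 uC vD => t ut vt; rewrite normrZ /= mulrACA.
exact: ler_pM.
Qed.

Lemma dominated_mulmx k k' {m n p} (u : T -> 'M[R]_(m, n)) (v : T -> 'M[R]_(n, p)) :
  dominated k u -> dominated k' v -> dominated (k \* k') (fun t => u t *m v t).
Proof.
move=> [C C0 uC] [D D0 vD]; exists (n%:R * (C * D)); first by rewrite !mulr_ge0.
apply: filterS2 uC vD => t ut vt; rewrite (le_trans (normr_mulmx_le _ _))//.
by rewrite -mulrA ler_wpM2l//= mulrACA ler_pM.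
Qed.

Lemma dominated_sum {V : normedModType R} k n (u : 'I_n -> T -> V) :
  (\forall t \near F, 0 <= k t) ->
  (forall i, dominated k (u i)) -> dominated k (fun t => \sum_i u i t).
Proof.
move=> k0; elim: n u => [|n IHn] u du.
  exists 0 => //; apply: filterS k0 => t kt.
  by rewrite big_ord0 normr0 mul0r.
apply: (dominated_eq (u := fun t => \sum_(i < n) u (widen_ord (leqnSn n) i) t + u ord_max t)).
  by apply: nearW => t; rewrite big_ord_recr.
by apply: dominatedD => //; apply: IHn.
Qed.

Lemma dominated_mx k m n (u : T -> 'M[R]_(m, n)) :
  (\forall t \near F, 0 <= k t) ->
  (forall i j, dominated k (fun t => u t i j)) -> dominated k u.
Proof.
move=> k0 du; pose v (ij : 'I_m * 'I_n) t := `|u t ij.1 ij.2|.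
have [C C0 vC] : dominated k (fun t => \sum_(l < #|{: 'I_m * 'I_n}|) v (enum_val l) t).
  apply: dominated_sum => // l; apply: dominated_near (du _ _).
    by apply: nearW => t; rewrite normr_id.
  exact: nearW.
exists C => //; apply: filterS2 k0 vC => t kt.
move=> /(le_trans (ler_norm _)) vt; apply: normr_mx_le; first exact: mulr_ge0.
move=> i j; apply: le_trans vt.
rewrite (bigD1 (enum_rank (i, j)))//= /v enum_rankK/= lerDl sumr_ge0//.
Qed.

Lemma dominated_entry k m n (u : T -> 'M[R]_(m, n)) i j :
  dominated k u -> dominated k (fun t => u t i j).
Proof.
move=> du; apply: dominated_near du; last exact: nearW.
apply: nearW => t; exact: (normr_mx_ge (u t) i j).
Qed.

Lemma dominated_cst {V : normedModType R} (c : V) :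
  dominated (fun=> 1) (fun=> c).
Proof. by exists `|c| => //; apply: nearW => t; rewrite mulr1. Qed.

Lemma dominated_continuous {U V : normedModType R} (f : U -> V) (z : T -> U) (a : U) :
  {for a, continuous f} -> z @ F --> a -> dominated (fun=> 1) (fun t => f (z t)).
Proof.
move=> cf za; exists (1 + `|f a|); first by rewrite addr_ge0.
have : f (z t) @[t --> F] --> f a by exact: (continuous_cvg _ cf za).
move=> /cvgrPdist_le /(_ _ ltr01); apply: filterS => t /= fz.
rewrite mulr1 -[f (z t)](subrK (f a)) (le_trans (ler_normD _ _))//.
by rewrite lerD2r distrC.
Qed.

End Dominated.

(** * The completion and its energy consistency *)

Section Completion.
Context {R : realType} {d : nat}.
Implicit Types (X : set 'cV[R]_d) (H : 'cV[R]_d -> R) (x y : 'cV[R]_d) (A : 'M[R]_d).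

Lemma midpointE x y : midpoint x y = (1 - 2^-1) *: x + 2^-1 *: y.
Proof.
by rewrite /midpoint scalerDr; congr (_ *: _ + _); lra.
Qed.

Lemma midpoint_in X x y : segment_in X x y -> X (midpoint x y).
Proof. by move=> Xxy; rewrite midpointE; apply: Xxy; lra. Qed.

Lemma sym_psd_expmx_Zmat X H A x h : open X -> class_C 2 X H -> X x ->
  sym_psd A -> sym_psd (expmx (Zmat H A x h) *m A).
Proof.
move=> oX CH Xx Apsd; have Bt := hessian_sym oX CH Xx; have [At _] := Apsd.
rewrite (_ : Zmat H A x h = 2 *: (2^-1 *: Zmat H A x h)); last first.
  by rewrite scalerA mulfV// scale1r.
apply: sym_psd_expmx => //; rewrite /Zmat !linearZ/= -!scalemxAl.
by rewrite -?scalemxAr !trmx_mul At Bt -?scalemxAr !mulmxA.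
Qed.

Lemma Rtilde4E H A x y h :
  Rtilde4 H A x y h = A + Zmat H A (midpoint x y) h *m A.
Proof. by rewrite /Rtilde4 /Zmat -scalemxAl scaleNr. Qed.

Section Expansion.
Context {T : Type} (F : set_system T) {FF : Filter F}.
Variables (X : set 'cV[R]_d) (H : 'cV[R]_d -> R) (A : 'M[R]_d).
Variables (z : T -> 'cV[R]_d) (h : T -> R) (z0 : 'cV[R]_d).
Hypotheses (CH : class_C 2 X H) (Xz0 : X z0).
Hypotheses (zz0 : z @ F --> z0) (h0 : h @ F --> 0).

Lemma dominated_hessian : dominated F (fun=> 1) (fun t => hessian H (z t)).
Proof.
apply: dominated_mx => [|i j]; first exact: nearW.
apply: (dominated_eq (u := fun t => partial i (partial j H) (z t))).
  by apply: nearW => t; rewrite mxE.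
by apply: dominated_continuous zz0; apply: ((CH.2 j).2 i).
Qed.

Lemma dominated_Zmat :
  dominated F (fun t => h t ^+ 2) (fun t => Zmat H A (z t) (h t)).
Proof.
have hB := dominated_hessian.
have hA : dominated F (fun=> 1) (fun=> A) by exact: dominated_cst.
have h2 : dominated F (fun t => h t ^+ 2) (fun t => - (h t ^+ 2 / 12)).
  exists 1 => //; apply: nearW => t; rewrite normrN ger0_norm ?divr_ge0 ?sqr_ge0//.
  by rewrite mul1r ler_pdivrMr// ler_peMr ?sqr_ge0//; lra.
have D : dominated F (fun t => h t ^+ 2 * (1 * 1 * 1 * 1))
    (fun t => Zmat H A (z t) (h t)).
  exact: (dominatedZ h2 (dominated_mulmx (dominated_mulmx (dominated_mulmx hA hB) hA) hB)).
by apply: dominated_le D; apply: nearW => t; rewrite !mulr1.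
Qed.

(** Eventually the scaled norm of [Z] is at most [1], and then
    [expmx_sub1_le] bounds the error by the square of [Z = O(h^2)]. *)
Lemma dominated_expmx_Zmat : dominated F (fun t => h t ^+ 4)
  (fun t => expmx (Zmat H A (z t) (h t)) *m A - (A + Zmat H A (z t) (h t) *m A)).
Proof.
have hA : dominated F (fun=> 1) (fun=> A) by exact: dominated_cst.
suff : dominated F (fun t => h t ^+ 4)
    (fun t => expmx (Zmat H A (z t) (h t)) - 1 - Zmat H A (z t) (h t)).
  move=> /dominated_mulmx /(_ hA) hexp.
  apply: (dominated_le (k := fun t => h t ^+ 4 * 1)).
    by apply: nearW => t; rewrite mulr1.
  apply: dominated_eq hexp; apply: nearW => t.
  by rewrite !mulmxBl mul1mx -addrA -opprD.
have [C C0 ZC] := dominated_Zmat.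
exists (expR 1 * (d%:R * C) ^+ 2); first by rewrite mulr_ge0 ?expR_ge0 ?sqr_ge0.
have dC0 : 0 <= d%:R * C by rewrite mulr_ge0.
have hs : \forall t \near F, d%:R * C * h t ^+ 2 <= 1.
  have : d%:R * C * (h t * h t) @[t --> F] --> d%:R * C * (0 * 0).
    by apply: cvgM; [exact: cvg_cst|exact: cvgM].
  rewrite !mulr0 => /cvgrPdist_le /(_ _ ltr01); apply: filterS => t.
  by rewrite sub0r normrN -expr2 => /(le_trans (ler_norm _)).
apply: filterS2 ZC hs => t Zt ht.
have Zd : d%:R * `|Zmat H A (z t) (h t)| <= d%:R * C * h t ^+ 2.
  by rewrite -mulrA ler_wpM2l.
rewrite (le_trans (expmx_sub1_le (le_trans Zd ht)))//.
rewrite -mulrA ler_wpM2l ?expR_ge0// (_ : h t ^+ 4 = (h t ^+ 2) ^+ 2); last first.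
  by rewrite -exprM.
rewrite -exprMn; apply: (lerXn2r _ _ _ Zd); rewrite nnegrE.
  by rewrite mulr_ge0.
by apply: mulr_ge0 => //; exact: sqr_ge0.
Qed.

End Expansion.

Lemma pointwise_sym_psd_Rexp X H A : open X -> class_C 2 X H -> sym_psd A ->
  pointwise_sym_psd X (Rexp H A).
Proof.
move=> oX CH Apsd x y h Xxy _.
exact: sym_psd_expmx_Zmat (midpoint_in Xxy) Apsd.
Qed.

Lemma dominated_cvg0 {T : Type} (F : set_system T) {FF : Filter F}
    {V : normedModType R} (k : T -> R) (u : T -> V) :
  dominated F k u -> k @ F --> 0 -> u @ F --> 0.
Proof.
move=> [C C0 uC] k0; apply: norm_cvg0.
apply: (@squeeze_cvgr _ _ _ _ (cst 0) (fun t => C * k t)).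
- by apply: filterS uC => t ->; rewrite normr_ge0.
- exact: cvg_cst.
- by rewrite -(mulr0 C); apply: cvgM => //; exact: cvg_cst.
Qed.

Lemma cvg_midpoint {T : Type} (F : set_system T) {FF : Filter F}
    (f g : T -> 'cV[R]_d) (x y : 'cV[R]_d) :
  f @ F --> x -> g @ F --> y -> midpoint (f t) (g t) @[t --> F] --> midpoint x y.
Proof. by move=> fx gy; apply: cvgZr; exact: cvgD. Qed.

Lemma sym_psd_completion_Rexp X H A : open X -> class_C 2 X H -> sym_psd A ->
  sym_psd_completion 4 X (Rtilde4 H A) (Rexp H A).
Proof.
move=> oX CH Apsd; split; first exact: pointwise_sym_psd_Rexp.
move=> x y Xxy F.
have FF : Filter F by exact: filter_prod_filter.
have c1 : (fun u : ('cV[R]_d * 'cV[R]_d) * R => u.1) @ F --> (x, y).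
  exact: cvg_fst.
have cx : (fun u : ('cV[R]_d * 'cV[R]_d) * R => u.1.1) @ F --> x.
  exact: (cvg_comp _ _ c1 cvg_fst).
have cy : (fun u : ('cV[R]_d * 'cV[R]_d) * R => u.1.2) @ F --> y.
  exact: (cvg_comp _ _ c1 cvg_snd).
have ch : (fun u : ('cV[R]_d * 'cV[R]_d) * R => u.2) @ F --> 0.
  apply: cvg_trans (cvg_snd) _; exact: cvg_within.
have [C C0 EC] := dominated_expmx_Zmat A CH (midpoint_in Xxy) (cvg_midpoint cx cy) ch.
apply/eqO_exP; exists (C + 1); first by rewrite ltr_wpDl.
apply: filterS EC => u uC; rewrite Rtilde4E (le_trans uC)//.
rewrite [`|_ ^+ _|]ger0_norm ?exprn_even_ge0//.
by rewrite ler_wpM2r ?exprn_even_ge0// lerDl.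
Qed.

Lemma energy_consistent_Rexp X H A : open X -> class_C 2 X H -> sym_psd A ->
  energy_consistent X H A (Rexp H A).
Proof.
move=> oX CH Apsd; split; first exact: pointwise_sym_psd_Rexp.
- move=> x Xx; set F := filter_prod _ _.
  have FF : Filter F by exact: filter_prod_filter.
  have cx : (fun u : 'cV[R]_d * R => x) @ F --> x by exact: cvg_cst.
  have cy : (fun u : 'cV[R]_d * R => u.1) @ F --> x by exact: cvg_fst.
  have ch : (fun u : 'cV[R]_d * R => u.2) @ F --> 0.
    apply: cvg_trans (cvg_snd) _; exact: cvg_within.
  have xx : midpoint x x = x.
    by rewrite midpointE -scalerDl subrK scale1r.
  have cm : (fun u : 'cV[R]_d * R => midpoint x u.1) @ F --> x.
    by rewrite -[X in _ --> X]xx; exact: cvg_midpoint.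
  have hp n : (fun u : 'cV[R]_d * R => u.2 ^+ n.+1) @ F --> 0.
    rewrite -[X in _ --> X](@expr0n R n.+1).
    exact: (continuous_cvg _ (@exprn_continuous R n.+1 0) ch).
  have E1 : (fun u : 'cV[R]_d * R => expmx (Zmat H A (midpoint x u.1) u.2) *m A
      - (A + Zmat H A (midpoint x u.1) u.2 *m A)) @ F --> (0 : 'M[R]_d).
    exact: (dominated_cvg0 (dominated_expmx_Zmat A CH Xx cm ch) (hp _)).
  have E2 : (fun u : 'cV[R]_d * R => Zmat H A (midpoint x u.1) u.2) @ F --> (0 : 'M[R]_d).
    apply: (dominated_cvg0 _ (hp 1%N)).
    exact: (dominated_Zmat A _ CH Xx cm).
  have E3 : Zmat H A (midpoint x u.1) u.2 *m A @[u --> F] --> (0 : 'M[R]_d) *m A.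
    by apply: cvg_mulmx => //; exact: cvg_cst.
  have E4 : (fun u : 'cV[R]_d * R => expmx (Zmat H A (midpoint x u.1) u.2) *m A
      - (A + Zmat H A (midpoint x u.1) u.2 *m A)
      + (A + Zmat H A (midpoint x u.1) u.2 *m A)) @ F --> 0 + (A + 0 *m A).
    apply: (cvgD E1); apply: (cvgD _ E3); exact: cvg_cst.
  rewrite mul0mx addr0 add0r in E4.
  rewrite (_ : (fun _ => _) = (fun u : 'cV[R]_d * R =>
    expmx (Zmat H A (midpoint x u.1) u.2) *m A
      - (A + Zmat H A (midpoint x u.1) u.2 *m A)
      + (A + Zmat H A (midpoint x u.1) u.2 *m A)))//.
  by apply/funext => u; rewrite subrK.
- move=> x y h [h0 Xxy E].
  have Rpsd := pointwise_sym_psd_Rexp oX CH Apsd Xxy h0.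
  exact: dissipation_le0 CH Xxy Rpsd h0 E.
- move=> A0 x y h [h0 Xxy]; rewrite /Rexp A0 mulmx0 mul0mx oppr0.
  move=> /(congr1 (fun v => h *: v)); rewrite scalerA mulfV ?gt_eqF// scale1r scaler0.
  by move=> /eqP; rewrite subr_eq0 => /eqP ->; rewrite subrr.
Qed.

End Completion.

(** * Taylor formula at the middle of a step *)

Section TaylorInTime.
Context {R : realType}.

(** One rung of the Taylor formula: two functions that agree at [s] and whose
    derivatives are [M]-close are [M (b - a)]-close.  Here [p] is a polynomial and
    [f] a derivative of the expanded function. *)
Lemma taylor_step (f df p dp : R -> R) (a b s M : R) :
  {within `[a, b], continuous f} ->
  (forall t : R, a < t < b -> is_derive t 1 f (df t)) ->
  (forall t : R, is_derive t 1 p (dp t)) ->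
  (forall t, a < t < b -> `|df t - dp t| <= M) ->
  a <= s <= b -> f s = p s ->
  forall t, a <= t <= b -> `|f t - p t| <= M * (b - a).
Proof.
move=> cf f' p' fpM sab fps t tab.
have cp : {within `[a, b], continuous p}.
  by apply: derivable_within_continuous => r _; have [] := p' r.
have cfp : {within `[a, b], continuous (fun r => f r - p r)}.
  by move=> r; apply: continuousB; [exact: cf|exact: cp].
have := @derivative_bound R (fun r => f r - p r) (fun r => df r - dp r) a b M cfp.
move=> /(_ _ fpM s t sab tab); rewrite fps subrr subr0 => H.
have {}H : `|f t - p t| <= M * `|t - s|.
  by apply: H => r rab; have ? := f' r rab; have ? := p' r; exact: is_deriveB.
apply: le_trans H _; case/andP: sab => sa sb; case/andP: tab => ta tb.
have [M0|M0] := leP 0 M; first by rewrite ler_wpM2l// ler_norml; lra.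
have [ab|ab] := ltP a b.
  have mab : a < (a + b) / 2 < b by lra.
  by have := le_lt_trans (le_trans (normr_ge0 _) (fpM _ mab)) M0; rewrite ltxx.
have ts : t = s by lra.
have ba : b = a by lra.
by rewrite ts ba !subrr normr0.
Qed.

(** On the open interval, because the derivatives of a solution are controlled at
    positive times only; the closed version is applied once, to the solution
    itself, which is continuous at time [0]. *)
Lemma taylor_step_open (f df p dp : R -> R) (a b s M : R) :
  (forall t : R, a < t < b -> is_derive t 1 f (df t)) ->
  (forall t : R, is_derive t 1 p (dp t)) ->
  (forall t, a < t < b -> `|df t - dp t| <= M) ->
  a < s < b -> f s = p s ->
  forall t, a < t < b -> `|f t - p t| <= M * (b - a).
Proof.
move=> f' p' fpM /andP[sa sb] fps t /andP[ta tb].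
pose c := Num.min s t; pose e := Num.max s t.
have [ac eb] : a < c /\ e < b by rewrite lt_min sa ta gt_max sb tb.
have ce : c <= s <= e /\ c <= t <= e by rewrite !ge_min !le_max !lexx !orbT.
have sub r : c <= r <= e -> a < r < b.
  by move=> /andP[cr re]; rewrite (lt_le_trans ac)// (le_lt_trans re).
have sub' r : c < r < e -> a < r < b.
  by move=> /andP[/ltW cr /ltW re]; apply: sub; rewrite cr.
have cf : {within `[c, e], continuous f}.
  apply: derivable_within_continuous => r; rewrite in_itv/= => /sub rab.
  by have [] := f' r rab.
have M0 : 0 <= M.
  by apply: le_trans (fpM s _); rewrite // sa.
apply: le_trans (taylor_step cf _ p' _ ce.1 fps ce.2) _.
- by move=> r /sub'; exact: f'.
- by move=> r /sub'; exact: fpM.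
by rewrite ler_wpM2l//; lra.
Qed.

Lemma is_derive_shiftX (s t : R) n :
  is_derive t 1 (fun r : R => (r - s) ^+ n.+1) (n.+1%:R * (t - s) ^+ n).
Proof.
have d1 : is_derive t 1 (fun r : R => r - s) (1 - 0).
  exact: is_deriveB.
have := is_deriveX n.+1 d1; rewrite subr0 [_%:A]mulr1.
by rewrite exprfctE.
Qed.

Lemma is_derive_taylor_poly (s a0 a1 a2 a3 t : R) :
  is_derive t 1 (fun r : R => a0 + (r - s) * a1 + (r - s) ^+ 2 / 2 * a2
     + (r - s) ^+ 3 / 6 * a3) (a1 + (t - s) * a2 + (t - s) ^+ 2 / 2 * a3).
Proof.
have -> : a1 + (t - s) * a2 + (t - s) ^+ 2 / 2 * a3 =
  0 + (1 * (t - s) ^+ 0) * a1 + (2 * (t - s) ^+ 1) / 2 * a2 + (3 * (t - s) ^+ 2) / 6 * a3.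
  by rewrite expr0 expr1; field.
have dX := is_derive_shiftX s t.
apply: is_deriveD; [apply: is_deriveD; [apply: is_deriveD|]|].
- exact: is_derive_mulr_cst (dX 0%N).
- exact: is_derive_mulr_cst (is_derive_mulr_cst _ (dX 1%N)).
- exact: is_derive_mulr_cst (is_derive_mulr_cst _ (dX 2%N)).
Qed.

(** Expanding at the middle of the step keeps the expansion point inside the
    domain of differentiability and separates even from odd powers, on which the
    cancellations below rest. *)
Lemma taylor_center (u : nat -> R -> R) (h K : R) : 0 < h ->
  {within `[0, h], continuous (u 0%N)} ->
  (forall n (t : R), (n < 4)%N -> 0 < t < h -> is_derive t 1 (u n) (u n.+1 t)) ->
  (forall t, 0 < t < h -> `|u 4%N t| <= K) ->
  let s := h / 2 in forall t, 0 <= t <= h ->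
  `|u 0%N t - (u 0%N s + (t - s) * u 1%N s + (t - s) ^+ 2 / 2 * u 2%N s
      + (t - s) ^+ 3 / 6 * u 3%N s)| <= K * h ^+ 4.
Proof.
move=> h0 cu du uK s.
have s0h : 0 < s < h by rewrite /s; lra.
have s0h' : 0 <= s <= h by rewrite /s; lra.
pose p n r := u n s + (r - s) * u n.+1 s + (r - s) ^+ 2 / 2 * u n.+2 s
     + (r - s) ^+ 3 / 6 * u n.+3 s.
(* Coefficients past the third are zero, so that every [q n.+1] is the derivative
   of [q n]. *)
pose v n := if (n < 4)%N then u n s else 0.
pose q n r := v n + (r - s) * v n.+1 + (r - s) ^+ 2 / 2 * v n.+2
     + (r - s) ^+ 3 / 6 * v n.+3.
have dq n (t : R) : is_derive t 1 (q n) (q n.+1 t).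
  have v4 : v n.+4 = 0 by [].
  rewrite /q v4 mulr0 addr0; exact: is_derive_taylor_poly.
have qs n : (n < 4)%N -> u n s = q n s.
  move=> n4; rewrite /q subrr {1}/v n4.
  by rewrite !expr0n/= !mul0r !addr0.
(* Downwards in the order of derivation: each rung gains a factor [h]. *)
have open_bound k : (k < 4)%N -> forall t, 0 < t < h ->
    `|u (4 - k)%N t - q (4 - k)%N t| <= K * h ^+ k.
  elim: k => [_|k IHk k4] t t0h.
    by rewrite subn0 expr0 mulr1 /q /v/= !mulr0 !addr0 subr0; exact: uK.
  have k4' := ltnW k4; rewrite exprSr mulrA.
  have nE : (4 - k = (4 - k.+1).+1)%N by rewrite subnSK.
  have n4 : (4 - k.+1 < 4)%N by rewrite -nE leq_subr.
  have IH r : 0 < r < h -> `|u (4 - k.+1).+1 r - q (4 - k.+1).+1 r| <= K * h ^+ k.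
    by rewrite -nE; exact: IHk.
  have := taylor_step_open (fun r r0h => du _ r n4 r0h) (fun r => dq _ r) IH s0h
    (qs _ n4) t0h.
  by rewrite subr0.
move=> t t0h; have := taylor_step cu (fun r => du 0%N r isT) (fun r => dq 0%N r)
  (open_bound 3 isT) s0h' (qs 0%N isT) t0h.
by rewrite subr0 -mulrA -exprSr /q /v.
Qed.
End TaylorInTime.

(** * Asymptotics in the step size, uniform on the unit interval *)

Section DominatedTaylor.
Context {R : realType} {d : nat}.
Implicit Types (X : set 'cV[R]_d) (G : 'cV[R]_d -> R).

(** A ball is convex, so the segment estimates apply between any two of its
    points with the constant [K]. *)
Lemma bounded_on_ball X (a : 'cV[R]_d) (I : finType) (g : I -> 'cV[R]_d -> R) :
  open X -> X a -> (forall i, {for a, continuous (g i)}) ->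
  exists r K : R, [/\ 0 < r, 0 <= K, ball a r `<=` X &
    forall z i, ball a r z -> `|g i z| <= K].
Proof.
move=> oX Xa cg; pose K : R := \sum_i (1 + `|g i a|).
have gK : \forall z \near a, forall i, `|g i z| <= K.
  have := @filter_forall 'cV[R]_d I (fun i z => `|g i z| <= K) (nbhs a) _.
  apply => i.
  have gi : \forall z \near a, `|g i a - g i z| <= 1.
    by move: (cg i) => /cvgrPdist_le /(_ _ ltr01).
  apply: filterS gi => z gz; rewrite /K (bigD1 i)//=.
  apply: (@le_trans _ _ (1 + `|g i a|)).
    by rewrite -lerBlDr (le_trans (lerB_dist _ _))// distrC.
  by rewrite lerDl sumr_ge0// => j _; rewrite addr_ge0.
have nX : \forall z \near a, X z by exact: open_nbhs_nbhs.
have /nbhs_ballP[r /= r0 rX] : \forall z \near a, X z /\ forall i, `|g i z| <= K.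
  by apply: filterS2 nX gK.
exists r, K; split => //.
- by rewrite sumr_ge0// => i _; rewrite addr_ge0.
- by move=> z /rX[].
- by move=> z i /rX[].
Qed.

Context {T : Type} (F : set_system T) {FF : Filter F}.
Variables (X : set 'cV[R]_d) (a : 'cV[R]_d) (u v : T -> 'cV[R]_d).
Hypotheses (oX : open X) (Xa : X a) (ua : u @ F --> a) (va : v @ F --> a).

Let near_ball (w : T -> 'cV[R]_d) r : 0 < r -> w @ F --> a ->
  \forall t \near F, ball a r (w t).
Proof. by move=> r0 /cvg_ballP; apply. Qed.

Lemma dominated_lipschitz G : class_C 1 X G ->
  dominated F (fun t => `|v t - u t|) (fun t => G (v t) - G (u t)).
Proof.
move=> [dG cpG]; have cpGa i : {for a, continuous (partial i G)} by exact: cpG.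
have [r [K [r0 K0 rX GK]]] := bounded_on_ball oX Xa cpGa.
exists (d%:R * K); first by rewrite mulr_ge0.
apply: filterS2 (near_ball r0 ua) (near_ball r0 va) => t ut vt.
rewrite -mulrA; apply: (lipschitz_on_segment K0 (segment_in_ball ut vt)).
  by move=> z /rX; exact: dG.
by move=> z i; exact: GK.
Qed.

Lemma dominated_taylor2 G : class_C 2 X G ->
  dominated F (fun t => `|v t - u t| ^+ 2)
    (fun t => G (v t) - G (u t) - \sum_i partial i G (u t) * (v t - u t) i 0).
Proof.
move=> [dG cpG].
have cpGa (ij : 'I_d * 'I_d) : {for a, continuous (partial ij.2 (partial ij.1 G))}.
  by apply: ((cpG ij.1).2 ij.2).
have [r [K [r0 K0 rX GK]]] := bounded_on_ball oX Xa cpGa.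
exists (d%:R * d%:R * K); first by rewrite !mulr_ge0.
apply: filterS2 (near_ball r0 ua) (near_ball r0 va) => t ut vt.
apply: (taylor2_on_segment K0 (segment_in_ball ut vt)).
- by move=> z /rX; exact: dG.
- by move=> z i /rX; exact: (cpG i).1.
- by move=> z i j; exact: (GK z (i, j)).
Qed.

End DominatedTaylor.

Section StepFilter.
Context {R : realType}.

(** A point [(h, xi)] is a step size with a position on the unit interval.  A
    property holds near this filter when it holds for small [h > 0] and for all
    [xi] at once. *)
Definition step_filter : set_system (R * R) :=
  [set P | \forall h \near 0^'+, forall xi, 0 <= xi <= 1 -> P (h, xi)].

#[global] Instance step_filter_filter : Filter step_filter.
Proof.
split.
- by apply: nearW.
- move=> P Q; rewrite /step_filter /=; apply: filterS2 => h hP hQ xi xi01.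
  by split; [exact: hP|exact: hQ].
- move=> P Q PQ; rewrite /step_filter /=; apply: filterS => h hP xi xi01.
  exact/PQ/hP.
Qed.

Lemma near_stepP (P : R * R -> Prop) :
  (\forall t \near step_filter, P t) <->
  (\forall h \near 0^'+, forall xi, 0 <= xi <= 1 -> P (h, xi)).
Proof. by []. Qed.

Lemma near_stepW (P : R -> Prop) : (\forall h \near 0^'+, P h) ->
  \forall t \near step_filter, P t.1.
Proof. by move=> hP; apply/near_stepP; apply: filterS hP. Qed.

Lemma near_step01 : \forall t \near step_filter, 0 <= t.2 <= 1.
Proof. by apply/near_stepP; apply: nearW. Qed.

Lemma dominated_at {V : normedModType R} (k : R -> R) (u : R * R -> V) (c : R) :
  0 <= c <= 1 -> dominated step_filter (fun t => k t.1) u ->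
  dominated step_filter (fun t => k t.1) (fun t => u (t.1, c)).
Proof.
move=> c01 [C C0 /near_stepP uC]; exists C => //; apply/near_stepP.
by apply: filterS uC => h /(_ c c01) uC xi _.
Qed.

(** An estimate of an integrand that is uniform in [xi] gives the same estimate of
    its integral [v]. *)
Lemma dominated_primitive (k v : R -> R) (df : R -> R -> R) :
  (\forall h \near 0^'+, exists f : R -> R, [/\ {within `[0, 1], continuous f},
    forall t : R, 0 < t < 1 -> is_derive t 1 f (df h t) & f 1 - f 0 = v h]) ->
  dominated step_filter (fun t => k t.1) (fun t => df t.1 t.2) ->
  dominated step_filter (fun t => k t.1) (fun t => v t.1).
Proof.
move=> f' [C C0 /near_stepP dfC]; exists C => //; apply/near_stepP.
apply: filterS2 f' dfC => h [f [cf f' fE]] dfC xi _ /=; rewrite -fE.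
have := @derivative_bound R f (df h) 0 1 (C * k h) cf f' _ 0 1.
rewrite subr0 normr1 mulr1 ?lexx ?ler01 => H; apply: H => //.
by move=> t /andP[/ltW t0 /ltW t1]; apply: dfC; rewrite t0.
Qed.

End StepFilter.

Section StepO.
Context {R : realType}.
Local Notation F := (@step_filter R).

Lemma near_step_lt (e : R) : 0 < e -> \forall t \near F, 0 < t.1 < e.
Proof.
move=> e0; apply: (near_stepW (P := fun h => 0 < h < e)).
near=> h; apply/andP; split; near: h; first exact: nbhs_right_gt.
exact: nbhs_right_lt.
Unshelve. all: by end_near. Qed.

(** [u = O(h^p)], uniformly in [xi]. *)
Definition stepO {V : normedModType R} (p : nat) (u : R * R -> V) :=
  dominated F (fun t => t.1 ^+ p) u.

Lemma near_gauge_ge0 p : \forall t \near F, 0 <= t.1 ^+ p.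
Proof.
by apply: filterS (near_step_lt ltr01) => t /andP[t0 _]; rewrite exprn_ge0// ltW.
Qed.

Lemma stepO_le {V : normedModType R} p q (u : R * R -> V) : (q <= p)%N ->
  stepO p u -> stepO q u.
Proof.
move=> qp; apply: dominated_le; apply: filterS (near_step_lt ltr01) => t.
by move=> /andP[t0 t1]; rewrite ler_wiXn2l// ltW.
Qed.

Lemma stepO0 {V : normedModType R} (u : R * R -> V) :
  dominated F (fun=> 1) u -> stepO 0 u.
Proof. by apply: dominated_le; apply: nearW => t; rewrite expr0. Qed.

Lemma stepOZ {V : normedModType R} p q (a : R * R -> R) (u : R * R -> V) :
  stepO p a -> stepO q u -> stepO (p + q) (fun t => a t *: u t).
Proof.
move=> pa qu; have D : dominated F (fun t => t.1 ^+ p * t.1 ^+ q) (fun t => a t *: u t).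
  exact: (dominatedZ pa qu).
by apply: dominated_le D; apply: nearW => t; rewrite exprD.
Qed.

Lemma stepOM p q (a b : R * R -> R) :
  stepO p a -> stepO q b -> stepO (p + q) (fun t => a t * b t).
Proof. exact: stepOZ. Qed.

Lemma stepO_mulmx p q {m n l} (u : R * R -> 'M[R]_(m, n)) (v : R * R -> 'M[R]_(n, l)) :
  stepO p u -> stepO q v -> stepO (p + q) (fun t => u t *m v t).
Proof.
move=> pu qv; have D : dominated F (fun t => t.1 ^+ p * t.1 ^+ q) (fun t => u t *m v t).
  exact: (dominated_mulmx pu qv).
by apply: dominated_le D; apply: nearW => t; rewrite exprD.
Qed.

Lemma stepO_sum {V : normedModType R} p n (u : 'I_n -> R * R -> V) :
  (forall i, stepO p (u i)) -> stepO p (fun t => \sum_i u i t).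
Proof. by move=> pu; apply: dominated_sum => //; exact: near_gauge_ge0. Qed.

Lemma stepO_mx p m n (u : R * R -> 'M[R]_(m, n)) :
  (forall i j, stepO p (fun t => u t i j)) -> stepO p u.
Proof. by move=> pu; apply: dominated_mx => //; exact: near_gauge_ge0. Qed.

Lemma stepO_cst {V : normedModType R} (c : V) : stepO 0 (fun=> c).
Proof. by apply: stepO0; exact: dominated_cst. Qed.

Lemma stepO_step p : stepO p (fun t => t.1 ^+ p).
Proof.
exists 1 => //; apply: filterS (near_gauge_ge0 p) => t t0.
by rewrite mul1r ger0_norm.
Qed.

Lemma stepO_xi : stepO 0 (fun t => t.2).
Proof.
exists 1 => //; apply: filterS (@near_step01 R) => t /andP[t0 t1].
by rewrite expr0 mulr1 ger0_norm.
Qed.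

Lemma stepO_step_inv {V : normedModType R} p (u : R * R -> V) :
  stepO p.+1 u -> stepO p (fun t => t.1^-1 *: u t).
Proof.
move=> [C C0 uC]; exists C => //; apply: filterS2 uC (near_step_lt ltr01).
move=> t ut /andP[t0 _]; rewrite normrZ gtr0_norm ?invr_gt0//.
by rewrite mulrC ler_pdivrMr// -mulrA -exprSr.
Qed.

Lemma stepO_dominated {V : normedModType R} p (k : R * R -> R) (u : R * R -> V) :
  stepO p k -> dominated F k u -> stepO p u.
Proof.
move=> [C C0 kC] [D D0 uD]; exists (D * C); first exact: mulr_ge0.
apply: filterS2 kC uD => t kt ut; rewrite (le_trans ut)// -mulrA ler_wpM2l//.
by rewrite (le_trans _ kt)// ler_norm.
Qed.

Lemma stepO_sqr_norm {V : normedModType R} p (u : R * R -> V) :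
  stepO p u -> stepO (p + p) (fun t => `|u t| ^+ 2).
Proof.
move=> [C C0 uC]; exists (C ^+ 2); first exact: sqr_ge0.
apply: filterS2 uC (near_gauge_ge0 p) => t ut t0.
rewrite exprD -expr2 -exprMn ger0_norm ?sqr_ge0//.
by apply: (lerXn2r _ _ _ ut); rewrite nnegrE// mulr_ge0.
Qed.

Lemma stepO_at {V : normedModType R} p (u : R * R -> V) (c : R) :
  0 <= c <= 1 -> stepO p u -> stepO p (fun t => u (t.1, c)).
Proof. exact: (@dominated_at _ _ (fun h => h ^+ p)). Qed.

Lemma stepO_eq {V : normedModType R} p (u v : R * R -> V) :
  (forall t, u t = v t) -> stepO p u -> stepO p v.
Proof. by move=> uv; apply: dominated_eq; exact: nearW. Qed.

Lemma stepOD {V : normedModType R} p (u v : R * R -> V) :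
  stepO p u -> stepO p v -> stepO p (fun t => u t + v t).
Proof. exact: dominatedD. Qed.

Lemma stepOB {V : normedModType R} p (u v : R * R -> V) :
  stepO p u -> stepO p v -> stepO p (fun t => u t - v t).
Proof. exact: dominatedB. Qed.

Lemma stepOZ0 {V : normedModType R} p (a : R * R -> R) (u : R * R -> V) :
  stepO 0 a -> stepO p u -> stepO p (fun t => a t *: u t).
Proof. exact: stepOZ. Qed.

Lemma stepO_1xi : stepO 0 (fun t : R * R => 1 - t.2).
Proof. by apply: stepOB; [exact: stepO_cst|exact: stepO_xi]. Qed.

Lemma stepO_centered : stepO 0 (fun t : R * R => 2 * t.2 - 1).
Proof.
apply: stepOB; last exact: stepO_cst.
by apply: (stepOM (p := 0) (q := 0)); [exact: stepO_cst|exact: stepO_xi].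
Qed.

Lemma stepO_step_cst p c : stepO p (fun t : R * R => t.1 ^+ p * c).
Proof.
rewrite -[p]addn0; apply: stepOM; last exact: stepO_cst.
by rewrite addn0; exact: stepO_step.
Qed.

(** Meant for a Hessian entry [G], with value [B] at the middle of the chord and
    slope [D = O(h)], times a deviation [e] from the chord with even part [a] and
    odd part [b = O(h^3)].  The product of the slope with [b] is of order four and
    drops out. *)
Lemma stepO_product_expansion (G B D e a b : R * R -> R) :
  stepO 2 (fun t => G t - B t - (t.2 - 1 / 2) * D t) ->
  stepO 0 B -> stepO 1 D -> stepO 2 e -> stepO 4 (fun t => e t - (a t + b t)) ->
  stepO 3 b ->
  stepO 4 (fun t => G t * e t - (B t * (a t + b t) + (t.2 - 1 / 2) * D t * a t)).
Proof.
move=> OG OB OD Oe Oeab Ob.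
have Os : stepO 0 (fun t : R * R => t.2 - 1 / 2).
  by apply: stepOB; [exact: stepO_xi|exact: stepO_cst].
have OsD := stepOM Os OD.
have D1 := stepOM OG Oe.
have D2 := stepOM (stepOD OB (stepO_le (isT : (0 <= 1)%N) OsD)) Oeab.
have D3 := stepOM OsD Ob.
have S := stepOD D1 (stepOD D2 D3).
by apply: stepO_eq S => t; ring.
Qed.

Lemma stepO_entry p m n (u : R * R -> 'M[R]_(m, n)) i j :
  stepO p u -> stepO p (fun t => u t i j).
Proof. exact: dominated_entry. Qed.

Lemma stepO_norm {V : normedModType R} p (u : R * R -> V) :
  stepO p u -> stepO p (fun t => `|u t|).
Proof.
move=> Ou; apply: dominated_near Ou; last exact: nearW.
by apply: nearW => t; rewrite normr_id.
Qed.

Lemma stepO_quadratic {V : normedModType R} p (u : R * R -> V) : stepO p u ->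
  stepO (2 + p) (fun t => (t.1 ^+ 2 / 12) *: u t).
Proof. by apply: stepOZ; exact: stepO_step_cst. Qed.

End StepO.

(** * The average vector field near a point *)

Section AvfEstimates.
Context {R : realType} {d : nat}.
Variables (X : set 'cV[R]_d) (H : 'cV[R]_d -> R) (A : 'M[R]_d) (x0 : 'cV[R]_d).
Hypotheses (oX : open X) (Xx0 : X x0) (CH : class_C 3 X H).
Implicit Types (u v : R -> 'cV[R]_d).
Local Notation F := (@step_filter R).

Let C_partial i : class_C 2 X (partial i H). Proof. exact: CH.2. Qed.

Let C_partial2 i j : class_C 1 X (partial i (partial j H)).
Proof. exact: (C_partial j).2. Qed.

Lemma cvg_step u : u h @[h --> 0^'+] --> x0 -> u t.1 @[t --> F] --> x0.
Proof.
move=> ux; apply/cvgrPdist_lt => e e0.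
move/cvgrPdist_lt : ux => /(_ _ e0) ue.
exact: (near_stepW (P := fun h => `|x0 - u h| < e)).
Qed.

Lemma cvg_of_step (u : R -> 'cV[R]_d) :
  u t.1 @[t --> F] --> x0 -> u h @[h --> 0^'+] --> x0.
Proof.
move=> /cvgrPdist_lt ux; apply/cvgrPdist_lt => e e0.
have /near_stepP := ux _ e0; apply: filterS => h /(_ 0).
by apply; rewrite lexx ler01.
Qed.

Lemma cvg_step_segment u : u h @[h --> 0^'+] --> x0 ->
  (1 - t.2) *: x0 + t.2 *: u t.1 @[t --> F] --> x0.
Proof.
move=> /cvg_step/cvgrPdist_lt ux; apply/cvgrPdist_lt => e e0.
apply: filterS2 (ux _ e0) (@near_step01 R) => t ut /andP[t0 t1].
rewrite scalerBl scale1r -addrA opprD addNKr opprD opprK -scalerBr.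
rewrite normrZ ger0_norm// (le_lt_trans _ ut)// ler_piMl//.
Qed.

Lemma near_segment_in u : u h @[h --> 0^'+] --> x0 ->
  \forall h \near 0^'+, segment_in X x0 (u h).
Proof.
move=> ux; have /nbhs_ballP[r /= r0 rX] : nbhs x0 X by exact: open_nbhs_nbhs.
have /cvg_ballP /(_ _ r0) := ux; apply: filterS => h uh.
exact: segment_in_sub rX (segment_in_ball (ballxx _ r0) uh).
Qed.

Lemma stepO_avf u : u h @[h --> 0^'+] --> x0 -> stepO 0 (fun t => avf H x0 (u t.1)).
Proof.
move=> ux; apply: stepO_mx => i j; rewrite [j]ord1.
apply: (dominated_primitive (k := fun h => h ^+ 0) (v := fun h => avf H x0 (u h) i 0)
  (df := fun h t => grad H ((1 - t) *: x0 + t *: u h) i 0)).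
  apply: filterS (near_segment_in ux) => h Xh.
  have [f fP] := avf_antiderivative (class_CS CH) Xh.
  by exists (f i).
apply: stepO0; apply: (dominated_eq (u := fun t =>
    partial i H ((1 - t.2) *: x0 + t.2 *: u t.1))).
  by apply: nearW => t; rewrite gradE.
apply: dominated_continuous (cvg_step_segment ux).
exact: class_C_continuous (C_partial i) Xx0.
Qed.

Lemma dominated_avf_sub u v :
  u h @[h --> 0^'+] --> x0 -> v h @[h --> 0^'+] --> x0 ->
  dominated F (fun t => `|v t.1 - u t.1|)
    (fun t => avf H x0 (v t.1) - avf H x0 (u t.1)).
Proof.
move=> ux vx; apply: dominated_mx => [|i j]; first exact: nearW.
rewrite [j]ord1.
apply: (dominated_primitive (k := fun h => `|v h - u h|)
  (v := fun h => (avf H x0 (v h) - avf H x0 (u h)) i 0)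
  (df := fun h t => grad H ((1 - t) *: x0 + t *: v h) i 0
     - grad H ((1 - t) *: x0 + t *: u h) i 0)).
  apply: filterS2 (near_segment_in ux) (near_segment_in vx) => h Xu Xv.
  have [f fP] := avf_antiderivative (class_CS CH) Xu.
  have [g gP] := avf_antiderivative (class_CS CH) Xv.
  have [cf f' fE] := fP i; have [cg g' gE] := gP i.
  exists (fun t => g i t - f i t); split.
  - by move=> t; apply: continuousB; [exact: cg|exact: cf].
  - by move=> t t01; have ? := f' t t01; have ? := g' t t01; exact: is_deriveB.
  - rewrite subr_mxE.
    have aux (a b c e p q : R) : a - b = p -> c - e = q ->
      a - c - (b - e) = p - q by move=> <- <-; ring.
    exact: aux gE fE.
apply: dominated_near (dominated_lipschitz oX Xx0
  (cvg_step_segment ux) (cvg_step_segment vx) (class_CS (C_partial i))).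
  by apply: nearW => t; rewrite !gradE lexx.
apply: filterS (@near_step01 R) => t /andP[t0 t1].
rewrite opprD addrACA subrr add0r -scalerBr normrZ ger0_norm//.
by rewrite ler_piMl.
Qed.

Lemma dominated_hessian_sub u v :
  u h @[h --> 0^'+] --> x0 -> v h @[h --> 0^'+] --> x0 ->
  dominated F (fun t => `|v t.1 - u t.1|)
    (fun t => hessian H (v t.1) - hessian H (u t.1)).
Proof.
move=> ux vx; apply: dominated_mx => [|i j]; first exact: nearW.
apply: dominated_eq (dominated_lipschitz oX Xx0 (cvg_step ux) (cvg_step vx)
  (C_partial2 i j)).
by apply: nearW => t; rewrite !mxE.
Qed.

Lemma stepO_hessian u : u h @[h --> 0^'+] --> x0 -> stepO 0 (fun t => hessian H (u t.1)).
Proof.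
move=> ux; apply: stepO0; exact: (dominated_hessian (class_CS CH) Xx0 (cvg_step ux)).
Qed.

End AvfEstimates.

(** * Time derivatives along the flow *)

Section LieDerivatives.
Context {R : realType} {d : nat}.
Implicit Types (X : set 'cV[R]_d) (H G : 'cV[R]_d -> R) (A : 'M[R]_d) (z : 'cV[R]_d).

Definition vector_field H A z : 'cV[R]_d := - (A *m grad H z).

(** The iterated Lie derivatives of the [j]-th coordinate: along a solution [x],
    [lie n j (x t)] is the [n]-th time derivative of the [j]-th coordinate. *)
Fixpoint lie H A (n : nat) (j : 'I_d) : 'cV[R]_d -> R :=
  match n with
  | 0 => fun z => z j 0
  | n'.+1 => fun z => \sum_i partial i (lie H A n' j) z * vector_field H A z i 0
  end.

Definition lie_vec H A n z : 'cV[R]_d := \col_j lie H A n j z.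

Lemma vector_fieldE H A z j :
  vector_field H A z j 0 = \sum_k - A j k * partial k H z.
Proof.
rewrite /vector_field !mxE -sumrN; apply: eq_bigr => k _.
by rewrite gradE mulNr.
Qed.

Lemma class_C_vector_field k X H A j : open X -> class_C k.+1 X H ->
  class_C k X (fun z => vector_field H A z j 0).
Proof.
move=> oX CH; apply: (class_C_ext (F := fun z => \sum_k - A j k * partial k H z)) => //.
  by move=> z _; rewrite vector_fieldE.
apply: class_C_sum => // i; apply: class_CM => //; first exact: class_C_cst.
exact: CH.2.
Qed.

(** Each Lie derivative costs one order of differentiability of [H]. *)
Lemma class_C_lie X H A n l j : open X -> class_C (n + l) X H ->
  class_C l X (lie H A n j).
Proof.
move=> oX; elim: n l => [|n IHn] l CH; first exact: class_C_coord.
have CHn : class_C (n + l.+1) X H by rewrite addnS.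
apply: class_C_sum => // i; apply: class_CM => //.
  exact: (IHn _ CHn).2.
apply: class_C_vector_field => //; apply: class_C_le CHn.
by rewrite leq_addl.
Qed.

Lemma lie_vec1 H A z : lie_vec H A 1 z = vector_field H A z.
Proof.
apply/matrixP => j k; rewrite [k]ord1 mxE /=.
rewrite (bigD1 j)//= big1 => [|i ij]; rewrite partial_coord mxE.
  by rewrite !eqxx mul1r addr0.
by rewrite eq_sym (negbTE ij) mul0r.
Qed.

(** The second derivative of a solution of [x' = f x] is the Jacobian of [f] times
    [f]; for [f = - A g] that Jacobian is [- A B]. *)
Lemma lie_vec2 X H A z : open X -> class_C 2 X H -> X z ->
  lie_vec H A 2 z = - (A *m hessian H z *m vector_field H A z).
Proof.
move=> oX CH Xz; rewrite -[hessian H z](hessian_sym oX CH Xz).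
apply/matrixP => j k; rewrite [k]ord1 -mulmxA mxE /= -mulNmx mxE.
have dlie i : partial i (lie H A 1 j) z = \sum_k - A j k * partial i (partial k H) z.
  rewrite /partial; have -> : lie H A 1 j = fun z => \sum_k - A j k * partial k H z.
    apply/funext => y; rewrite -vector_fieldE -lie_vec1 mxE//.
  rewrite (_ : (fun _ => _) = \sum_k (fun y => - A j k * partial k H y)); last first.
    by apply/funext => y; rewrite fct_sumE.
  have dH l : derivable (partial l H) z (delta_mx i 0).
    by apply: diff_derivable; exact: (CH.2 l).1.
  rewrite derive_sum => [|l]; last exact: derivableZ.
  by apply: eq_bigr => l _; rewrite (@deriveZ _ _ _ (partial l H) (- A j l)).
under eq_bigr do rewrite dlie mulr_suml.
rewrite exchange_big/=; apply: eq_bigr => l _.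
rewrite !mxE mulr_sumr; apply: eq_bigr => i _.
by rewrite !mxE mulrA.
Qed.

Lemma is_derive_lie X H A n j (x : R -> 'cV[R]_d) (t : R) : open X ->
  class_C n.+1 X H -> X (x t) -> is_derive t 1 x (vector_field H A (x t)) ->
  is_derive t 1 (fun s => lie H A n j (x s)) (lie H A n.+1 j (x t)).
Proof.
move=> oX CH Xx dx; apply: is_derive_comp_curve => //.
have CH' : class_C (n + 1) X H by rewrite addn1.
exact: (class_C_lie A j oX CH').1.
Qed.

End LieDerivatives.

#[global] Arguments lie : simpl never.

(** * Integrating the gradient along a curve and along its chord *)

Section ChordExpansion.
Context {R : realType} {d : nat}.
Local Notation F := (@step_filter R).

Variables (x0 : 'cV[R]_d) (xe : R -> 'cV[R]_d) (y : R * R -> 'cV[R]_d).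
Variables (c0 c1 c2 c3 : R -> 'cV[R]_d).
Hypotheses (y0 : forall h, y (h, 0) = x0) (y1 : forall h, y (h, 1) = xe h).
Hypotheses (Oc1 : stepO 0 (fun t => c1 t.1)) (Oc2 : stepO 0 (fun t => c2 t.1))
  (Oc3 : stepO 0 (fun t => c3 t.1)).
Hypothesis (Oy : stepO 4 (fun t => y t - (c0 t.1
    + (t.1 * t.2 - t.1 / 2) *: c1 t.1
    + ((t.1 * t.2 - t.1 / 2) ^+ 2 / 2) *: c2 t.1
    + ((t.1 * t.2 - t.1 / 2) ^+ 3 / 6) *: c3 t.1))).

Definition chord (t : R * R) : 'cV[R]_d := (1 - t.2) *: x0 + t.2 *: xe t.1.

(** Deviation from the chord produced by the second derivative [c2] at the middle
    of the step: [tau^2 - s^2] with [s = h / 2] and [tau = s (2 xi - 1)], divided by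
    two. *)
Definition even_part (t : R * R) : 'cV[R]_d :=
  (t.1 ^+ 2 / 8 * ((2 * t.2 - 1) ^+ 2 - 1)) *: c2 t.1.

(** Deviation produced by the third derivative: [tau^3 - tau s^2] divided by
    six. *)
Definition odd_part (t : R * R) : 'cV[R]_d :=
  (t.1 ^+ 3 / 48 * ((2 * t.2 - 1) ^+ 3 - (2 * t.2 - 1))) *: c3 t.1.

Let rem t := y t - (c0 t.1
    + (t.1 * t.2 - t.1 / 2) *: c1 t.1
    + ((t.1 * t.2 - t.1 / 2) ^+ 2 / 2) *: c2 t.1
    + ((t.1 * t.2 - t.1 / 2) ^+ 3 / 6) *: c3 t.1).

Let Orem0 : stepO 4 (fun t => rem (t.1, 0)).
Proof. by apply: (@stepO_at _ _ 4 rem 0) Oy; rewrite lexx ler01. Qed.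

Let Orem1 : stepO 4 (fun t => rem (t.1, 1)).
Proof. by apply: (@stepO_at _ _ 4 rem 1) Oy; rewrite lexx ler01. Qed.

(** Subtract from the Taylor formula its linear interpolation between [xi = 0] and
    [xi = 1]: constant and linear terms disappear. *)
Lemma stepO_chord_error :
  stepO 4 (fun t => y t - chord t - (even_part t + odd_part t)).
Proof.
have D := stepOB (stepOB Oy (stepOZ0 stepO_1xi Orem0)) (stepOZ0 (@stepO_xi R) Orem1).
apply: stepO_eq D => t; rewrite /rem y0 y1 /chord /even_part /odd_part /=.
by apply/matrixP => i j; rewrite !mxE; field.
Qed.

Lemma stepO_even_part : stepO 2 even_part.
Proof.
apply: (stepOZ (p := 2) (q := 0)) Oc2.
apply: (stepOM (p := 2) (q := 0)); first exact: stepO_step_cst.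
apply: stepOB; last exact: stepO_cst.
exact: (stepOM (p := 0) (q := 0) stepO_centered stepO_centered).
Qed.

Lemma stepO_odd_part : stepO 3 odd_part.
Proof.
apply: (stepOZ (p := 3) (q := 0)) Oc3.
apply: (stepOM (p := 3) (q := 0)); first exact: stepO_step_cst.
apply: stepOB; last exact: stepO_centered.
apply: (stepOM (p := 0) (q := 0) stepO_centered).
exact: (stepOM (p := 0) (q := 0) stepO_centered stepO_centered).
Qed.

Lemma stepO_chord_gap : stepO 2 (fun t => y t - chord t).
Proof.
have D := stepOD (stepO_le (isT : (2 <= 4)%N) stepO_chord_error)
  (stepOD stepO_even_part (stepO_le (isT : (2 <= 3)%N) stepO_odd_part)).
by apply: stepO_eq D => t; rewrite subrK.
Qed.

Lemma stepO_increment : stepO 3 (fun t => xe t.1 - x0 - t.1 *: c1 t.1).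
Proof.
have D := stepOD (stepO_le (isT : (3 <= 4)%N) (stepOB Orem1 Orem0))
  (stepOZ (p := 3) (q := 0) (stepO_step_cst 3 24^-1) Oc3).
apply: stepO_eq D => t; rewrite /rem y0 y1 /=.
by apply/matrixP => i j; rewrite !mxE; field.
Qed.

Lemma stepO_chord_length : stepO 1 (fun t => xe t.1 - x0).
Proof.
have D := stepOD (stepO_le (isT : (1 <= 3)%N) stepO_increment)
  (stepOZ (p := 1) (q := 0) (stepO_step_cst 1 1) Oc1).
by apply: stepO_eq D => t; rewrite mulr1 expr1 subrK.
Qed.

Lemma stepO_midpoint : stepO 2 (fun t => midpoint x0 (xe t.1) - c0 t.1).
Proof.
have D := stepOD (stepO_le (isT : (2 <= 4)%N)
   (stepOZ0 (stepO_cst (2^-1 : R)) (stepOD Orem1 Orem0)))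
  (stepOZ (p := 2) (q := 0) (stepO_step_cst 2 8^-1) Oc2).
apply: stepO_eq D => t; rewrite /rem y0 y1 /midpoint /=.
by apply/matrixP => i j; rewrite !mxE; field.
Qed.

End ChordExpansion.

Section GradientExpansion.
Context {R : realType} {d : nat}.
Local Notation F := (@step_filter R).

Variables (X : set 'cV[R]_d) (H : 'cV[R]_d -> R) (A : 'M[R]_d) (x0 : 'cV[R]_d).
Hypotheses (oX : open X) (Xx0 : X x0) (CH : class_C 4 X H).
Variables (xe : R -> 'cV[R]_d) (y : R * R -> 'cV[R]_d) (c2 c3 : R -> 'cV[R]_d).
Hypotheses (xex0 : xe h @[h --> 0^'+] --> x0) (yx0 : y t @[t --> F] --> x0).
Hypotheses (Oc2 : stepO 0 (fun t => c2 t.1)) (Oc3 : stepO 0 (fun t => c3 t.1)).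
Hypotheses (Ow : stepO 1 (fun t => xe t.1 - x0))
  (Oe : stepO 2 (fun t => y t - chord x0 xe t))
  (Oeab : stepO 4 (fun t => y t - chord x0 xe t - (even_part c2 t + odd_part c3 t))).

Let mp h := midpoint x0 (xe h).

Let C1 k : class_C 3 X (partial k H). Proof. exact: CH.2. Qed.
Let C2 j k : class_C 2 X (partial j (partial k H)). Proof. exact: (C1 k).2. Qed.
Let C3 l j k : class_C 1 X (partial l (partial j (partial k H))).
Proof. exact: (C2 j k).2. Qed.

Lemma cvg_chord_midpoint : mp h @[h --> 0^'+] --> x0.
Proof.
have -> : x0 = midpoint x0 x0 by rewrite midpointE -scalerDl subrK scale1r.
by apply: cvg_midpoint => //; exact: cvg_cst.
Qed.

Let slope j k h := \sum_l partial l (partial j (partial k H)) (mp h) * (xe h - x0) l 0.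

Let Oslope j k : stepO 1 (fun t => slope j k t.1).
Proof.
apply: stepO_sum => l; apply: (stepOM (p := 0) (q := 1)).
  apply: stepO0; apply: dominated_continuous (cvg_step cvg_chord_midpoint).
  exact: class_C_continuous (C3 l j k) Xx0.
exact: stepO_entry Ow.
Qed.

Lemma chord_sub_midpoint t :
  chord x0 xe t - mp t.1 = (t.2 - 1 / 2) *: (xe t.1 - x0).
Proof.
by rewrite /chord /mp /midpoint; apply/matrixP => i j; rewrite !mxE; field.
Qed.

Let Ohess_chord j k : stepO 2 (fun t => partial j (partial k H) (chord x0 xe t)
  - partial j (partial k H) (mp t.1) - (t.2 - 1 / 2) * slope j k t.1).
Proof.
have Os : stepO 0 (fun t : R * R => t.2 - 1 / 2).
  by apply: stepOB; [exact: stepO_xi|exact: stepO_cst].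
have Og : stepO 2 (fun t => `|chord x0 xe t - mp t.1| ^+ 2).
  apply: (stepO_sqr_norm (p := 1)); have := stepOZ0 Os Ow.
  by apply: stepO_eq => t; rewrite chord_sub_midpoint.
apply: (stepO_dominated Og).
apply: dominated_eq (dominated_taylor2 oX Xx0 (cvg_step cvg_chord_midpoint)
  (cvg_step_segment xex0) (C2 j k)).
apply: nearW => t; congr (_ - _).
rewrite -/(chord x0 xe t) chord_sub_midpoint /slope mulr_sumr.
by apply: eq_bigr => l _; rewrite mxE mulrCA.
Qed.

(** Component [k] of the Hessian at the middle of the chord applied to [c2]. *)
Definition curvature k h := \sum_j partial j (partial k H) (mp h) * c2 h j 0.

Let beta k h := \sum_j (partial j (partial k H) (mp h) * (h ^+ 3 / 48 * c3 h j 0)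
   + h ^+ 2 / 16 * (slope j k h * c2 h j 0)).

(** The deviation from the chord is [O(h^2)], so the first order Taylor formula for
    the gradient is exact up to [O(h^4)]; its Hessian on the chord is in turn
    expanded at the middle of the chord.  Besides the even deviation times the
    Hessian, all terms are odd in [2 xi - 1]. *)
Lemma stepO_gradient_expansion : exists b : 'I_d -> R -> R, forall k, stepO 4 (fun t =>
  partial k H (y t) - partial k H (chord x0 xe t)
  - (curvature k t.1 * (t.1 ^+ 2 / 8 * ((2 * t.2 - 1) ^+ 2 - 1))
     + b k t.1 * ((2 * t.2 - 1) ^+ 3 - (2 * t.2 - 1)))).
Proof.
exists beta => k.
have Og : stepO 4 (fun t => `|y t - chord x0 xe t| ^+ 2).
  exact: (stepO_sqr_norm (p := 2)).
have D1 : stepO 4 (fun t => partial k H (y t) - partial k H (chord x0 xe t)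
    - \sum_j partial j (partial k H) (chord x0 xe t) * (y t - chord x0 xe t) j 0).
  apply: (stepO_dominated Og).
  exact: (dominated_taylor2 oX Xx0 (cvg_step_segment xex0) yx0 (class_CS (C1 k))).
have OB j : stepO 0 (fun t => partial j (partial k H) (mp t.1)).
  apply: stepO0; apply: dominated_continuous (cvg_step cvg_chord_midpoint).
  exact: class_C_continuous (C2 j k) Xx0.
have D2 : stepO 4 (fun t => \sum_j (
    partial j (partial k H) (chord x0 xe t) * (y t - chord x0 xe t) j 0
    - (partial j (partial k H) (mp t.1) * (even_part c2 t j 0 + odd_part c3 t j 0)
       + (t.2 - 1 / 2) * slope j k t.1 * even_part c2 t j 0))).
  apply: stepO_sum => j; apply: stepO_product_expansion.
  - exact: Ohess_chord.
  - exact: OB.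
  - exact: Oslope.
  - exact: stepO_entry Oe.
  - apply: stepO_eq (stepO_entry j 0 Oeab) => t.
    by rewrite subr_mxE; congr (_ - _); rewrite mxE.
  - exact: stepO_entry (stepO_odd_part Oc3).
apply: stepO_eq (stepOD D1 D2) => t.
rewrite sumrB addrA subrK; congr (_ - _).
rewrite /curvature /beta !mulr_suml -big_split/=; apply: eq_bigr => j _.
have evenE : even_part c2 t j 0 = t.1 ^+ 2 / 8 * ((2 * t.2 - 1) ^+ 2 - 1) * c2 t.1 j 0.
  by rewrite mxE.
have oddE : odd_part c3 t j 0 =
    t.1 ^+ 3 / 48 * ((2 * t.2 - 1) ^+ 3 - (2 * t.2 - 1)) * c3 t.1 j 0.
  by rewrite mxE.
rewrite evenE oddE.
move: (partial j (partial k H) (mp t.1)) (slope j k t.1) (c2 t.1 j 0) (c3 t.1 j 0).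
by move=> b s e o; field.
Qed.

End GradientExpansion.

Section AverageExpansion.
Context {R : realType} {d : nat}.
Local Notation F := (@step_filter R).

(** Primitives of the even and of the odd factor of the gradient expansion, in
    powers of [xi - 1 / 2]: over the unit interval the first has increment
    [- 2 / 3] and the second [0]. *)
Lemma is_derive_quartic (a b t : R) :
  is_derive t 1 (fun r : R => a * (4 / 3 * (r - 1 / 2) ^+ 3 - (r - 1 / 2) ^+ 1)
      + b * (2 * (r - 1 / 2) ^+ 4 - (r - 1 / 2) ^+ 2))
    (a * ((2 * t - 1) ^+ 2 - 1) + b * ((2 * t - 1) ^+ 3 - (2 * t - 1))).
Proof.
have dX n := is_derive_shiftX (1 / 2) t n.
have dXc n c := is_derive_mulr_cst c (dX n).
have d1 := dXc 2%N (a * (4 / 3)); have d2 := dXc 0%N (- a).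
have d3 := dXc 3%N (b * 2); have d4 := dXc 1%N (- b).
have D := is_deriveD (is_deriveD d1 d2) (is_deriveD d3 d4).
rewrite (_ : a * _ + b * _ = 3 * (t - 1 / 2) ^+ 2 * (a * (4 / 3)) + 1 * (t - 1 / 2) ^+ 0 * - a
   + (4 * (t - 1 / 2) ^+ 3 * (b * 2) + 2 * (t - 1 / 2) ^+ 1 * - b)); last by field.
rewrite (_ : (fun r => _) = (fun r : R =>
     (r - 1 / 2) ^+ 3 * (a * (4 / 3)) + (r - 1 / 2) ^+ 1 * - a
   + ((r - 1 / 2) ^+ 4 * (b * 2) + (r - 1 / 2) ^+ 2 * - b))); first exact: D.
by apply/funext => r; field.
Qed.

Variables (X : set 'cV[R]_d) (H : 'cV[R]_d -> R) (A : 'M[R]_d) (x0 : 'cV[R]_d).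
Hypotheses (oX : open X) (Xx0 : X x0) (CH : class_C 2 X H).
Variables (xe : R -> 'cV[R]_d) (y : R * R -> 'cV[R]_d) (al be : 'I_d -> R -> R).
Hypotheses (xex0 : xe h @[h --> 0^'+] --> x0).
Hypotheses (y0 : forall h, y (h, 0) = x0) (y1 : forall h, y (h, 1) = xe h).
Hypothesis (dy : \forall h \near 0^'+, forall i,
  {within `[0, 1], continuous (fun xi => y (h, xi) i 0)} /\
  forall xi : R, 0 < xi < 1 ->
    is_derive xi 1 (fun xi => y (h, xi) i 0) (h * vector_field H A (y (h, xi)) i 0)).
Hypothesis (Og : forall k, stepO 4 (fun t =>
  partial k H (y t) - partial k H (chord x0 xe t)
  - (al k t.1 * (t.1 ^+ 2 / 8 * ((2 * t.2 - 1) ^+ 2 - 1))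
     + be k t.1 * ((2 * t.2 - 1) ^+ 3 - (2 * t.2 - 1))))).

Let gap k h xi : R := partial k H (y (h, xi))
  - partial k H ((1 - xi) *: x0 + xi *: xe h)
  - (al k h * (h ^+ 2 / 8 * ((2 * xi - 1) ^+ 2 - 1))
     + be k h * ((2 * xi - 1) ^+ 3 - (2 * xi - 1))).

(** Since [y] solves the differential equation in the time [h xi], [y / h] is a
    primitive of [- A g] on the curve; [avf] comes from a primitive of [g] on the
    chord.  Adding a primitive of the expansion leaves a function whose derivative
    is [- A] times its remainder, hence [O(h^4)]. *)
Lemma stepO_average_entry i : stepO 4 (fun t =>
  t.1^-1 * (xe t.1 i 0 - x0 i 0)
  + \sum_k A i k * (avf H x0 (xe t.1) k 0 - t.1 ^+ 2 / 12 * al k t.1)).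
Proof.
apply: (dominated_primitive (k := fun h => h ^+ 4)
  (v := fun h => h^-1 * (xe h i 0 - x0 i 0)
     + \sum_k A i k * (avf H x0 (xe h) k 0 - h ^+ 2 / 12 * al k h))
  (df := fun h xi => \sum_k - A i k * gap k h xi)); last first.
  apply: stepO_sum => k; apply: (stepOM (p := 0) (q := 4)); first exact: stepO_cst.
  by apply: stepO_eq (Og k) => -[].
have hpos : \forall h \near (0 : R)^'+, 0 < h by exact: nbhs_right_gt.
apply: filterS3 dy (near_segment_in oX Xx0 xex0) hpos => h dyh Xh h0.
have [f fP] := avf_antiderivative CH Xh.
have [cy y'] := dyh i.
pose q k (r : R) := al k h * (h ^+ 2 / 8) * (4 / 3 * (r - 1 / 2) ^+ 3 - (r - 1 / 2) ^+ 1)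
   + be k h * (2 * (r - 1 / 2) ^+ 4 - (r - 1 / 2) ^+ 2).
have dq k (r : R) := is_derive_quartic (al k h * (h ^+ 2 / 8)) (be k h) r.
have cq k : {within `[0, 1], continuous (q k)}.
  by apply: derivable_within_continuous => r _; have [] := dq k r.
have cfq k : {within `[0, 1], continuous (fun r => f k r + q k r)}.
  have [cf _ _] := fP k.
  by move=> r; apply: continuousD; [exact: cf|exact: cq].
have cyh : {within `[0, 1], continuous (fun r => y (h, r) i 0 * h^-1)}.
  exact: within_continuous_mulr.
have cs : {within `[0, 1], continuous (fun r => \sum_k (f k r + q k r) * A i k)}.
  by apply: within_continuous_sum => k; exact: within_continuous_mulr.
exists (fun r => y (h, r) i 0 * h^-1 + \sum_k (f k r + q k r) * A i k); split.
- exact: within_continuous_add.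
- move=> r r01.
  have D1 := is_derive_mulr_cst h^-1 (y' r r01).
  have D2 k : is_derive r 1 (fun r => (f k r + q k r) * A i k)
     ((grad H ((1 - r) *: x0 + r *: xe h) k 0
       + (al k h * (h ^+ 2 / 8) * ((2 * r - 1) ^+ 2 - 1)
          + be k h * ((2 * r - 1) ^+ 3 - (2 * r - 1)))) * A i k).
    apply: is_derive_mulr_cst; have [_ + _] := fP k => /(_ r r01) f'.
    by have ? := dq k r; exact: is_deriveD.
  have D := is_deriveD D1 (is_derive_sum_fun D2).
  have E : \sum_k - A i k * gap k h r = h * vector_field H A (y (h, r)) i 0 / h
     + \sum_k ((grad H ((1 - r) *: x0 + r *: xe h) k 0
       + (al k h * (h ^+ 2 / 8) * ((2 * r - 1) ^+ 2 - 1)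
          + be k h * ((2 * r - 1) ^+ 3 - (2 * r - 1)))) * A i k).
    rewrite mulrAC mulfV ?gt_eqF// mul1r vector_fieldE -big_split/=.
    apply: eq_bigr => k _; rewrite /gap gradE.
    move: (partial k H (y (h, r))) (partial k H _) (A i k) (al k h) (be k h).
    by move=> p1 p2 p3 p4 p5; ring.
  by rewrite E; exact: D.
- have aux (a b c s1 s2 s3 : R) : s1 - s2 = s3 -> a * c + s1 - (b * c + s2) = c * (a - b) + s3.
    by move=> <-; ring.
  rewrite y1 y0; apply: aux; rewrite -sumrB; apply: eq_bigr => k _.
  have [_ _ <-] := fP k; rewrite /q.
  move: (f k 1) (f k 0) (A i k) (al k h) (be k h) => p1 p2 p3 p4 p5.
  by field.
Qed.

Lemma stepO_average : stepO 4 (fun t =>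
  t.1^-1 *: (xe t.1 - x0) + A *m avf H x0 (xe t.1)
  - (t.1 ^+ 2 / 12) *: (A *m \col_k al k t.1)).
Proof.
apply: stepO_mx => i j; rewrite [j]ord1.
apply: stepO_eq (stepO_average_entry i) => t.
have E (c e : R) (v w a b : 'cV[R]_d) :
   (c *: (v - w) + A *m a - e *: (A *m b)) i 0 =
   c * (v i 0 - w i 0) + \sum_k A i k * (a k 0 - e * b k 0).
  rewrite !mxE; rewrite -addrA; congr (_ + _); rewrite mulr_sumr -sumrB.
  by apply: eq_bigr => k _; ring.
rewrite E; congr (_ + _); apply: eq_bigr => k _; congr (_ * (_ - _ * _)).
by rewrite mxE.
Qed.

End AverageExpansion.

(** * Residual of the exact solution *)

Lemma taylor_col_entry {R : realType} {d : nat} (v a : 'cV[R]_d)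
    (p q r : 'I_d -> R) (b c e : R) j :
  (v - (a + b *: (\col_i p i) + c *: (\col_i q i) + e *: (\col_i r i))) j 0
  = v j 0 - (a j 0 + b * p j + c * q j + e * r j).
Proof. by rewrite !mxE. Qed.

Lemma cancel_increment {R : realType} {d : nat} (h : R) (w p q e : 'cV[R]_d) :
  h != 0 -> h^-1 *: w + p - q - h^-1 *: (w - h *: e) + q = p + e.
Proof. by move=> h0; apply/matrixP => i j; rewrite !mxE; field. Qed.

Lemma cancel_middle {R : realType} {d : nat} (A P B : 'M[R]_d) (p q : 'cV[R]_d) :
  - (A *m ((P - B) *m p) + A *m (B *m (A *m q + p)))
  = - (A *m P *m p) - A *m (B *m (A *m q)).
Proof.
rewrite mulmxBl mulmxBr !mulmxDr -!mulmxA.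
move: (A *m (P *m p)) (A *m (B *m p)) (A *m (B *m (A *m q))) => u v w.
by apply/matrixP => i j; rewrite !mxE; ring.
Qed.

Lemma cancel_correction {R : realType} {d : nat} (s : R) (w p q r : 'cV[R]_d) :
  w + p - s *: q + s *: (q - r) = w + (p - s *: r).
Proof. by apply/matrixP => i j; rewrite !mxE; ring. Qed.

Section ExactSolution.
Context {R : realType} {d : nat}.
Variables (X : set 'cV[R]_d) (H : 'cV[R]_d -> R) (A : 'M[R]_d) (x0 : 'cV[R]_d).
Variables (x : R -> 'cV[R]_d) (T : R).
Hypotheses (oX : open X) (CH : class_C 6 X H) (T0 : 0 < T) (xE0 : x 0 = x0).
Hypotheses (cx : {within `[0, T[, continuous x}).
Hypotheses (Xx : forall t, 0 <= t < T -> X (x t)).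
Hypotheses (dx : forall t : R, 0 < t < T -> is_derive t 1 x (vector_field H A (x t))).
Local Notation F := (@step_filter R).

Let Xx0 : X x0. Proof. by rewrite -xE0; apply: Xx; rewrite lexx. Qed.

(** Continuity at time [0] alone gives convergence along any choice of times in
    [[0, h]]. *)
Lemma cvg_exact (theta : R * R -> R) :
  (\forall t \near F, 0 <= theta t <= t.1) -> x (theta t) @[t --> F] --> x0.
Proof.
move=> th; have c0 : x @ within `[0, T[ (nbhs 0) --> x 0.
  have /subspace_continuousP := cx; apply.
  by rewrite /= in_itv/= lexx.
apply/cvgrPdist_lt => e e0; move/cvgrPdist_lt : c0 => /(_ _ e0).
rewrite xE0 => /nbhs_ballP[r /= r0 rx].
apply: filterS3 th (near_step_lt r0) (near_step_lt T0) => t.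
move=> /andP[t0 th1] /andP[_ tr] /andP[_ tT].
apply: rx.
  by rewrite -ball_normE/= sub0r normrN ger0_norm// (le_lt_trans th1).
by rewrite /= in_itv/= t0 (le_lt_trans th1).
Qed.

Lemma cvg_exact_xi : x (t.1 * t.2) @[t --> F] --> x0.
Proof.
apply: cvg_exact; apply: filterS2 (near_step_lt ltr01) (@near_step01 R).
move=> t /andP[h0 _] /andP[t0 t1].
by rewrite mulr_ge0 ?(ltW h0)// ler_piMr// ltW.
Qed.

Lemma cvg_exact_mid : x (t.1 / 2) @[t --> F] --> x0.
Proof.
apply: cvg_exact; apply: filterS (near_step_lt ltr01) => t /andP[h0 _].
by lra.
Qed.

Lemma cvg_exact_end : x h @[h --> 0^'+] --> x0.
Proof.
have th : \forall t \near F, 0 <= t.1 <= t.1.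
  by apply: filterS (near_step_lt ltr01) => t /andP[/ltW -> _]/=.
have := cvg_exact th; move=> /cvgrPdist_lt xe; apply/cvgrPdist_lt => e e0.
have /near_stepP := xe _ e0; apply: filterS => h /(_ 0).
by apply; rewrite lexx ler01.
Qed.

Lemma stepO_lie_vec n : (n < 6)%N -> stepO 0 (fun t => lie_vec H A n (x (t.1 / 2))).
Proof.
move=> n6; apply: stepO_mx => i j; apply: stepO0.
have Cn : class_C (n + 1) X H by apply: class_C_le CH; rewrite addn1.
apply: (dominated_eq (u := fun t => lie H A n i (x (t.1 / 2)))).
  by apply: nearW => t; rewrite mxE.
apply: dominated_continuous cvg_exact_mid.
exact: class_C_continuous (class_C_lie A i oX Cn) Xx0.
Qed.

(** The fourth time derivative is a continuous function of the state, so it is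
    bounded as long as the solution stays in a ball around [x0]. *)
Lemma exact_taylor : stepO 4 (fun t =>
  x (t.1 * t.2) - (x (t.1 / 2)
    + (t.1 * t.2 - t.1 / 2) *: lie_vec H A 1 (x (t.1 / 2))
    + ((t.1 * t.2 - t.1 / 2) ^+ 2 / 2) *: lie_vec H A 2 (x (t.1 / 2))
    + ((t.1 * t.2 - t.1 / 2) ^+ 3 / 6) *: lie_vec H A 3 (x (t.1 / 2)))).
Proof.
have C5 : class_C (4 + 1) X H by apply: class_CS.
have cl j : {for x0, continuous (lie H A 4 j)}.
  exact: class_C_continuous (class_C_lie A j oX C5) Xx0.
have [r [K [r0 K0 rX lK]]] := bounded_on_ball oX Xx0 cl.
apply: stepO_mx => j k; rewrite [k]ord1.
exists K => //.
have /cvg_ballP /(_ _ r0) /near_stepP xb := cvg_exact_xi.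
have hT : \forall h \near 0^'+, 0 < h < T.
  have /near_stepP := near_step_lt T0; apply: filterS => h /(_ 0).
  by apply; rewrite lexx ler01.
apply/near_stepP; apply: filterS2 xb hT => h xb /andP[h0 hT] xi /andP[xi0 xi1].
pose u n s := lie H A n j (x s).
have inb s : 0 <= s <= h -> ball x0 r (x s).
  move=> /andP[s0 sh]; rewrite (_ : s = h * (s / h)); last by rewrite mulrC divfK// gt_eqF.
  by apply: xb; rewrite divr_ge0 ?(ltW h0)//= ler_pdivrMr// mul1r.
have cu : {within `[0, h], continuous (u 0%N)}.
  move=> s; apply: (@continuous_comp _ _ _ (x : subspace `[0, h] -> 'cV[R]_d)
     (fun y : 'cV[R]_d => y j 0)); last exact: coord_continuous.
  have cxh : {within `[0, h], continuous x}.
    by apply/(continuous_subspaceW _ cx)/subset_itv; rewrite ?bnd_simp.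
  exact: cxh s.
have du n (s : R) : (n < 4)%N -> 0 < s < h -> is_derive s 1 (u n) (u n.+1 s).
  move=> n4 /andP[s0 sh]; have sT := lt_trans sh hT.
  apply: (@is_derive_lie _ _ X) => //.
  - by apply: class_C_le CH; exact: (leq_trans n4).
  - by apply: Xx; rewrite (ltW s0).
  - by apply: dx; rewrite s0.
have uK s : 0 < s < h -> `|u 4%N s| <= K.
  by move=> /andP[/ltW s0 /ltW sh]; apply/lK/inb; rewrite s0.
have := taylor_center h0 cu du uK (t := h * xi).
rewrite mulr_ge0 ?(ltW h0)//= ler_piMr ?(ltW h0)// => /(_ isT) uE.
move=> /=.
rewrite taylor_col_entry; exact: uE.
Qed.

Let c n h := lie_vec H A n (x (h / 2)).

Let Oc n : (n < 6)%N -> stepO 0 (fun t => c n t.1).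
Proof. exact: stepO_lie_vec. Qed.

Let y (t : R * R) := x (t.1 * t.2).
Let y0 h : y (h, 0) = x0. Proof. by rewrite /y mulr0. Qed.
Let y1 h : y (h, 1) = x h. Proof. by rewrite /y mulr1. Qed.

Let Oc1 : stepO 0 (fun t => c 1 t.1). Proof. exact: Oc. Qed.
Let Oc2 : stepO 0 (fun t => c 2 t.1). Proof. exact: Oc. Qed.
Let Oc3 : stepO 0 (fun t => c 3 t.1). Proof. exact: Oc. Qed.

Let Oy : stepO 4 (fun t => y t - (x (t.1 / 2)
    + (t.1 * t.2 - t.1 / 2) *: c 1 t.1
    + ((t.1 * t.2 - t.1 / 2) ^+ 2 / 2) *: c 2 t.1
    + ((t.1 * t.2 - t.1 / 2) ^+ 3 / 6) *: c 3 t.1)).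
Proof. exact: exact_taylor. Qed.

Let Ow3 : stepO 3 (fun t => x t.1 - x0 - t.1 *: c 1 t.1).
Proof. exact: (stepO_increment (c0 := fun h => x (h / 2)) y0 y1 Oc3 Oy). Qed.

Let Ow : stepO 1 (fun t => x t.1 - x0).
Proof. exact: (stepO_chord_length (c0 := fun h => x (h / 2)) y0 y1 Oc1 Oc3 Oy). Qed.

Let Oe : stepO 2 (fun t => y t - chord x0 x t).
Proof. exact: (stepO_chord_gap (c0 := fun h => x (h / 2)) y0 y1 Oc2 Oc3 Oy). Qed.

Let Oeab : stepO 4 (fun t => y t - chord x0 x t
  - (even_part (c 2) t + odd_part (c 3) t)).
Proof. exact: (stepO_chord_error (c0 := fun h => x (h / 2)) y0 y1 Oy). Qed.

Let Omid : stepO 2 (fun t => midpoint x0 (x t.1) - x (t.1 / 2)).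
Proof. exact: (stepO_midpoint (c0 := fun h => x (h / 2)) y0 y1 Oc2 Oy). Qed.

Let near_dy : \forall h \near 0^'+, forall i,
  {within `[0, 1], continuous (fun xi => y (h, xi) i 0)} /\
  forall xi : R, 0 < xi < 1 ->
    is_derive xi 1 (fun xi => y (h, xi) i 0) (h * vector_field H A (y (h, xi)) i 0).
Proof.
have /near_stepP := near_step_lt T0; apply: filterS => h /(_ 0).
rewrite lexx ler01 => /(_ isT) /andP[/= h0 hT] i; split.
  apply/subspace_continuousP => xi /=; rewrite in_itv/= => /andP[xi0 xi1].
  have hxi r : 0 <= r <= 1 -> 0 <= h * r < T.
    move=> /andP[r0 r1]; rewrite mulr_ge0 ?(ltW h0)//= (le_lt_trans _ hT)//.
    by rewrite ler_piMr// ltW.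
  have /subspace_continuousP cxT := cx.
  have /cvgrPdist_lt cxi : x @ within `[0, T[ (nbhs (h * xi)) --> x (h * xi).
    by apply: cxT; rewrite /= in_itv/=; apply: hxi; rewrite xi0.
  apply/cvgrPdist_lt => e e0; have /nbhs_ballP[r /= r0 rx] := cxi _ e0.
  apply/nbhs_ballP; exists (r / h) => /=; first by rewrite divr_gt0.
  move=> z /= xiz; rewrite in_itv/= => z01.
  have hz : ball (h * xi) r (h * z).
    move: xiz; rewrite -!ball_normE/= -mulrBr normrM gtr0_norm//.
    by rewrite ltr_pdivlMr// mulrC.
  have := rx _ hz; rewrite /= in_itv/= hxi// => /(_ isT).
  apply: le_lt_trans; rewrite /y/=.
  by have := normr_mx_ge (x (h * xi) - x (h * z)) i 0; rewrite subr_mxE.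
move=> xi /andP[xi0 xi1]; have hxi : 0 < h * xi < T.
  by rewrite mulr_gt0//= (lt_trans _ hT)// -[ltRHS]mulr1 ltr_pM2l.
have Xhxi : X (x (h * xi)) by apply: Xx; case/andP: hxi => /ltW -> ->.
have C1 : class_C 1 X H by apply: class_C_le CH.
have D1 := is_derive_lie i oX C1 Xhxi (dx hxi).
have dh : is_derive xi 1 (fun r : R => h * r) h.
  rewrite (_ : (fun r => _) = (fun r : R => r * h)); first exact: is_derive_linear.
  by apply/funext => r; rewrite mulrC.
have D2 := is_derive1_comp D1 dh.
have E : lie H A 1 i (x (h * xi)) = vector_field H A (x (h * xi)) i 0.
  by rewrite -lie_vec1 mxE.
by rewrite /y/= mulrC -E; exact: D2.
Qed.

(** [stepO_average] for the Taylor coefficients of the exact solution; the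
    symmetry of the Hessian turns the curvature into a matrix product. *)
Lemma stepO_exact_average : stepO 4 (fun t =>
  t.1^-1 *: (x t.1 - x0) + A *m avf H x0 (x t.1)
  - (t.1 ^+ 2 / 12) *: (A *m (hessian H (midpoint x0 (x t.1)) *m c 2 t.1))).
Proof.
have C4 : class_C 4 X H by apply: class_C_le CH.
have C2 : class_C 2 X H by apply: class_C_le CH.
have [b Ob] := stepO_gradient_expansion oX Xx0 C4 cvg_exact_end cvg_exact_xi Oc3 Ow Oe Oeab.
have S := stepO_average oX Xx0 C2 cvg_exact_end y0 y1 near_dy Ob.
apply: dominated_eq S.
have Xh := near_segment_in oX Xx0 cvg_exact_end.
apply: filterS (near_stepW (P := fun h => segment_in X x0 (x h)) Xh) => t Xt.
congr (_ - _ *: (_ *m _)).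
rewrite -(hessian_sym oX C2 (midpoint_in Xt)).
apply/matrixP => k l; rewrite [l]ord1 !mxE /curvature.
by apply: eq_bigr => j _; rewrite !mxE.
Qed.

(** By [stepO_exact_average] it remains to see that [c2] and [A B A avf] differ by
    [O(h^2)].  The same lemma, read at order two, gives [A avf = - c1 + O(h^2)];
    moreover [c2] is [- A] times the Hessian at [x (h / 2)] times [c1], and that
    Hessian differs from [B] by [O(h^2)] because [x (h / 2)] is that close to the
    middle of the chord. *)
Lemma stepO_defect : stepO 4 (fun t =>
  t.1^-1 *: (x t.1 - x0) + Rtilde4 H A x0 (x t.1) t.1 *m avf H x0 (x t.1)).
Proof.
have C3 : class_C 3 X H by apply: class_C_le CH.
have C2 : class_C 2 X H by apply: class_C_le CH.
pose mp h := midpoint x0 (x h).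
have cmp : mp h @[h --> 0^'+] --> x0 by exact: cvg_chord_midpoint cvg_exact_end.
have cmid : x (h / 2) @[h --> 0^'+] --> x0.
  exact: (cvg_of_step (u := fun h => x (h / 2)) cvg_exact_mid).
pose B h := hessian H (mp h); pose a h := avf H x0 (x h).
have OB : stepO 0 (fun t => B t.1) by exact: (stepO_hessian Xx0 C3 cmp).
have OA : stepO 0 (fun t : R * R => A) by exact: stepO_cst.
have Sav : stepO 4 (fun t => t.1^-1 *: (x t.1 - x0) + A *m a t.1
  - (t.1 ^+ 2 / 12) *: (A *m (B t.1 *m c 2 t.1))) by exact: stepO_exact_average.
have hpos := near_step_lt (@ltr01 R).
have Oa : stepO 2 (fun t => A *m a t.1 + c 1 t.1).
  have OABc := stepO_quadratic (stepO_mulmx OA (stepO_mulmx OB Oc2)).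
  have D := stepOD (stepOB (stepO_le (isT : (2 <= 4)%N) Sav) (stepO_step_inv Ow3)) OABc.
  apply: dominated_eq D; apply: filterS hpos => t /andP[h0 _].
  exact: cancel_increment (lt0r_neq0 h0).
have OBc : stepO 2 (fun t => hessian H (x (t.1 / 2)) - B t.1).
  have O2 : stepO 2 (fun t => x (t.1 / 2) - mp t.1).
    have D : stepO 2 (fun t => - (midpoint x0 (x t.1) - x (t.1 / 2))).
      exact: dominatedN Omid.
    by apply: stepO_eq D => t; rewrite opprB.
  apply: (stepO_dominated (stepO_norm O2)).
  exact: (dominated_hessian_sub (u := mp) (v := fun h => x (h / 2)) oX Xx0 C3 cmp cmid).
have Oc2B : stepO 2 (fun t => c 2 t.1 - A *m (B t.1 *m (A *m a t.1))).
  have D1 := stepO_mulmx OA (stepO_mulmx OBc Oc1).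
  have D2 := stepO_mulmx OA (stepO_mulmx OB Oa).
  have D : stepO 2 (fun t => - (A *m ((hessian H (x (t.1 / 2)) - B t.1) *m c 1 t.1)
     + A *m (B t.1 *m (A *m a t.1 + c 1 t.1)))) by exact: dominatedN (stepOD D1 D2).
  apply: dominated_eq D; apply: filterS (near_step_lt T0) => t /andP[h0 hT].
  have Xmid : X (x (t.1 / 2)) by apply: Xx; lra.
  rewrite /c (lie_vec2 A oX C2 Xmid) -lie_vec1.
  exact: cancel_middle.
rewrite /Rtilde4 -/(mp _).
have OABc := stepO_quadratic (stepO_mulmx OA (stepO_mulmx OB Oc2B)).
apply: stepO_eq (stepOD Sav OABc) => t.
rewrite -/(B _) -/(a _) mulmxBl -scalemxAl !mulmxBr -!mulmxA.
exact: cancel_correction.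
Qed.
End ExactSolution.

(** * Stability and order four *)

Section Stability.
Context {R : realType} {d : nat}.
Local Notation F := (@step_filter R).

Lemma dominated_mulmx_bounded k m n l (u : R * R -> 'M[R]_(m, n))
    (v : R * R -> 'M[R]_(n, l)) :
  dominated F k u -> stepO 0 v -> dominated F k (fun t => u t *m v t).
Proof.
move=> ku bv; have D : dominated F (fun t => k t * t.1 ^+ 0) (fun t => u t *m v t).
  exact: (dominated_mulmx ku bv).
by apply: dominated_le D; apply: nearW => t; rewrite expr0 mulr1.
Qed.

Lemma bounded_mulmx_dominated k m n l (u : R * R -> 'M[R]_(m, n))
    (v : R * R -> 'M[R]_(n, l)) :
  stepO 0 u -> dominated F k v -> dominated F k (fun t => u t *m v t).
Proof.
move=> bu kv; have D : dominated F (fun t => t.1 ^+ 0 * k t) (fun t => u t *m v t).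
  exact: (dominated_mulmx bu kv).
by apply: dominated_le D; apply: nearW => t; rewrite expr0 mul1r.
Qed.

Lemma quintic_sub (A B C : 'M[R]_d) (s : R) :
  (A - s *: (A *m B *m A *m B *m A)) - (A - s *: (A *m C *m A *m C *m A))
  = - s *: (A *m (B - C) *m A *m B *m A + A *m C *m A *m (B - C) *m A).
Proof.
rewrite !mulmxBr !mulmxBl.
move: (A *m B *m A *m B *m A) (A *m C *m A *m C *m A) (A *m C *m A *m B *m A) => p q r.
by apply/matrixP => i j; rewrite !mxE; ring.
Qed.

Lemma mulmx_sub_split (P Q : 'M[R]_d) (a b : 'cV[R]_d) :
  (P - Q) *m a + Q *m (a - b) = P *m a - Q *m b.
Proof. by rewrite mulmxBl mulmxBr addrA subrK. Qed.

Variables (X : set 'cV[R]_d) (H : 'cV[R]_d -> R) (A : 'M[R]_d) (x0 : 'cV[R]_d).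
Hypotheses (oX : open X) (Xx0 : X x0) (CH : class_C 3 X H).
Variables (u v : R -> 'cV[R]_d).
Hypotheses (ux : u h @[h --> 0^'+] --> x0) (vx : v h @[h --> 0^'+] --> x0).

Let OA : stepO 0 (fun t : R * R => A). Proof. exact: stepO_cst. Qed.

Let Os : stepO 0 (fun t : R * R => - (t.1 ^+ 2 / 12)).
Proof.
have D : stepO 2 (fun t : R * R => t.1 ^+ 2 * - 12^-1) by exact: stepO_step_cst.
apply: (stepO_le (leq0n 2)); apply: stepO_eq D => t; ring.
Qed.

Lemma stepO_Rtilde4 : stepO 0 (fun t => Rtilde4 H A x0 (u t.1) t.1).
Proof.
have OB := stepO_hessian Xx0 CH (cvg_chord_midpoint ux).
have D := stepOD OA (stepOZ0 Os (stepO_mulmx (stepO_mulmx (stepO_mulmx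
  (stepO_mulmx OA OB) OA) OB) OA)).
by apply: stepO_eq D => t; rewrite /Rtilde4 scaleNr.
Qed.

Lemma dominated_Rtilde4_sub : dominated F (fun t => `|v t.1 - u t.1|)
  (fun t => Rtilde4 H A x0 (v t.1) t.1 - Rtilde4 H A x0 (u t.1) t.1).
Proof.
have cu := cvg_chord_midpoint ux; have cv := cvg_chord_midpoint vx.
have OB := stepO_hessian Xx0 CH cu.
have OC := stepO_hessian Xx0 CH cv.
have DB : dominated F (fun t => `|v t.1 - u t.1|)
    (fun t => hessian H (midpoint x0 (v t.1)) - hessian H (midpoint x0 (u t.1))).
  apply: dominated_le (dominated_hessian_sub oX Xx0 CH cu cv).
  apply: nearW => t; rewrite /midpoint -scalerBr opprD addrACA subrr add0r.
  by rewrite normrZ ger0_norm// ler_piMl//; lra.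
have D1 := dominated_mulmx_bounded (dominated_mulmx_bounded (dominated_mulmx_bounded
  (bounded_mulmx_dominated OA DB) OA) OC) OA.
have D2 := dominated_mulmx_bounded (bounded_mulmx_dominated
  (stepO_mulmx (stepO_mulmx OA OB) OA) DB) OA.
have D : dominated F (fun t => t.1 ^+ 0 * `|v t.1 - u t.1|) (fun t => - (t.1 ^+ 2 / 12) *:
   (A *m (hessian H (midpoint x0 (v t.1)) - hessian H (midpoint x0 (u t.1)))
      *m A *m hessian H (midpoint x0 (v t.1)) *m A
    + A *m hessian H (midpoint x0 (u t.1)) *m A
      *m (hessian H (midpoint x0 (v t.1)) - hessian H (midpoint x0 (u t.1))) *m A)).
  exact: (dominatedZ Os (dominatedD D1 D2)).
apply: dominated_near D; apply: nearW => t; last by rewrite expr0 mul1r.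
by rewrite /Rtilde4 quintic_sub.
Qed.

(** The matrix [A + Z A] and the average vector field are bounded near [x0] and
    depend on the end point of the step in a Lipschitz way, hence so does their
    product. *)
Lemma dominated_increment_sub : dominated F (fun t => `|v t.1 - u t.1|)
  (fun t => Rtilde4 H A x0 (v t.1) t.1 *m avf H x0 (v t.1)
          - Rtilde4 H A x0 (u t.1) t.1 *m avf H x0 (u t.1)).
Proof.
have D1 := dominated_mulmx_bounded dominated_Rtilde4_sub (stepO_avf oX Xx0 CH vx).
have D2 := bounded_mulmx_dominated stepO_Rtilde4 (dominated_avf_sub oX Xx0 CH ux vx).
have D : dominated F (fun t => `|v t.1 - u t.1|)
   (fun t => (Rtilde4 H A x0 (v t.1) t.1 - Rtilde4 H A x0 (u t.1) t.1) *m avf H x0 (v t.1)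
     + Rtilde4 H A x0 (u t.1) t.1 *m (avf H x0 (v t.1) - avf H x0 (u t.1))).
  exact: (dominatedD D1 D2).
by apply: dominated_eq D; apply: nearW => t; exact: mulmx_sub_split.
Qed.

End Stability.

(** The term [D |e|] costs at most half of the left-hand side once multiplied by
    [h]. *)
Lemma contraction_bound {R : realType} {d : nat} (h C D : R) (e : 'cV[R]_d) :
  0 < h -> 0 <= D -> D * h <= 1 / 2 ->
  `|h^-1 *: e| <= C * h ^+ 4 + D * `|e| -> `|e| <= 2 * C * h ^+ 5.
Proof.
move=> h0 D0 Dh; rewrite normrZ gtr0_norm ?invr_gt0// mulrC ler_pdivrMr//.
have : D * h * `|e| <= 1 / 2 * `|e| by rewrite ler_wpM2r.
have -> : (C * h ^+ 4 + D * `|e|) * h = C * h ^+ 5 + D * h * `|e| by ring.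
rewrite -(mulrA 2 C); move: (D * h * `|e|) `|e| (C * h ^+ 5) => p q r; lra.
Qed.

Lemma step_difference {R : realType} {d : nat} (h : R) (x0 x1 : 'cV[R]_d)
    (Q : 'M[R]_d) (a1 : 'cV[R]_d) : 0 < h -> h^-1 *: (x1 - x0) = - (Q *m a1) ->
  forall (P P1 : 'M[R]_d) (a x : 'cV[R]_d),
  h^-1 *: (x - x1) = h^-1 *: (x - x0) + P *m a + (Q - P1) *m a1
     + (P1 *m a1 - P *m a).
Proof.
move=> h0 E P P1 a x.
have -> : x - x1 = (x - x0) - (x1 - x0) by rewrite opprB addrA subrK.
rewrite scalerBr E mulmxBl; move: (P *m a) (Q *m a1) (P1 *m a1) => p q r.
by apply/matrixP => i j; rewrite !mxE; ring.
Qed.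

(** The error of one step, divided by [h], is the residual of the exact solution,
    plus the error of replacing the exponential by [A + Z A], plus a difference of
    increments. *)
Lemma method_of_order_Rexp {R : realType} {d : nat} (X : set 'cV[R]_d)
    (H : 'cV[R]_d -> R) (A : 'M[R]_d) : open X -> class_C 6 X H ->
  method_of_order 4 X H A (Rexp H A).
Proof.
move=> oX CH x0 x x1 [T T0 [xE0 cx Xx dx]] step x1x0 G.
have C3 : class_C 3 X H by apply: class_C_le CH.
have C2 : class_C 2 X H by apply: class_C_le CH.
have Xx0 : X x0 by rewrite -xE0; apply: Xx; rewrite lexx.
have xx0 : x h @[h --> 0^'+] --> x0 := cvg_exact_end T0 xE0 cx.
have Odef := stepO_defect oX CH T0 xE0 cx Xx dx.
have cmp := cvg_chord_midpoint x1x0.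
have c0 : (fun t : R * R => t.1) @ step_filter --> 0.
  apply/cvgrPdist_lt => e e0; apply: filterS (near_step_lt e0) => t /andP[t0 te].
  by rewrite sub0r normrN gtr0_norm.
have Oexp : stepO 4 (fun t => Rexp H A x0 (x1 t.1) t.1 - Rtilde4 H A x0 (x1 t.1) t.1).
  apply: dominated_eq (dominated_expmx_Zmat A C2 Xx0 (cvg_step cmp) c0).
  by apply: nearW => t; rewrite Rtilde4E.
have Oexpa := stepO_mulmx Oexp (stepO_avf oX Xx0 C3 x1x0).
have [C C0 /near_stepP HC] := stepOD Odef Oexpa.
have [D D0 /near_stepP HD] := dominated_increment_sub A oX Xx0 C3 xx0 x1x0.
have hsmall : \forall h \near (0 : R)^'+, D * h <= 1 / 2.
  have D1 : 0 < D + 1 by rewrite ltr_wpDl.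
  near=> h; have h0 : 0 < h by near: h; exact: nbhs_right_gt.
  have : h <= 1 / 2 / (D + 1) by near: h; apply: nbhs_right_le; rewrite divr_gt0.
  rewrite ler_pdivlMr// => h2; apply: le_trans h2.
  by rewrite mulrC mulrDr mulr1 lerDl ltW.
have unit01 : 0 <= (0 : R) <= 1 by rewrite lexx ler01.
apply/eqO_exP; exists (2 * C + 1); first by rewrite ltr_wpDl// mulr_ge0.
have err : \forall h \near (0 : R)^'+, `|x h - x1 h| <= 2 * C * h ^+ 5.
  apply: filterS3 HC HD (filterI step hsmall) => h /(_ 0 unit01)/= HC /(_ 0 unit01)/= HD.
  move=> [[h0 _ E] Dh]; apply: (contraction_bound h0 D0 Dh _).
  rewrite (step_difference h0 E (Rtilde4 H A x0 (x h) h) (Rtilde4 H A x0 (x1 h) h)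
     (avf H x0 (x h)) (x h)).
  rewrite (le_trans (ler_normD _ _))// lerD//; last by rewrite (distrC (x h)).
near=> h; have h0 : 0 < h by near: h; exact: nbhs_right_gt.
have he : `|x h - x1 h| <= 2 * C * h ^+ 5 by near: h.
rewrite (le_trans he)// ger0_norm ?exprn_ge0 ?(ltW h0)//.
by rewrite ler_wpM2r ?exprn_ge0 ?(ltW h0)// lerDl.
Unshelve. all: by end_near. Qed.

Theorem theorem6 :
  exists k : nat,
  forall (R : realType) (d : nat) (A : 'M[R]_d)
         (X : set 'cV[R]_d) (H : 'cV[R]_d -> R),
    sym_psd A -> open X -> class_C k X H ->
    [/\ sym_psd_completion 4 X (Rtilde4 H A) (Rexp H A),
        energy_consistent X H A (Rexp H A) &
        method_of_order 4 X H A (Rexp H A)].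
Proof.
exists 6%N => R d A X H Apsd oX CH.
have C2 : class_C 2 X H by apply: class_C_le CH.
split; first exact: sym_psd_completion_Rexp.
  exact: energy_consistent_Rexp.
exact: method_of_order_Rexp.
Qed.
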